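(* Let $\alpha\in(0,2]$ and $\nu>0$. Let $X_1,X_2,\ldots$ and $N_1,N_2,\ldots$ be random variables on a common probability space such that each $N_n$ takes only natural values, is independent of $X_1,X_2,\ldots$, and $N_n\to\infty$ in probability. Let $T_n=T_n(X_1,\ldots,X_n)$ be a statistic (a measurable function of $X_1,\ldots,X_n$) that is asymptotically normal, i.e. there exist $\sigma>0$ and $\theta\in\mathbb{R}$ with $$\mathsf{P}\big(\sigma\sqrt{n}(T_n-\theta)<x\big)\to\Phi(x)\quad\text{for all }x\in\mathbb{R},$$ and let $T_{N_n}(\omega)=T_{N_n(\omega)}(X_1(\omega),\ldots,X_{N_n(\omega)}(\omega))$. Then $$\sigma\sqrt{n}\big(T_{N_n}-\theta\big)\Longrightarrow L_{\alpha,\nu}$$ if and only if $$\frac{N_n}{n}\Longrightarrow \tfrac12 M_{\alpha/2,\nu}^{-1}.$$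
   Context: $\Longrightarrow$ denotes convergence in distribution as $n\to\infty$; $\Phi$ is the standard normal distribution function. $L_{\alpha,\nu}$ denotes a random variable with characteristic function $(1+|t|^{\alpha})^{-\nu}$, $t\in\mathbb{R}$. For $\delta\in(0,1]$, $\nu>0$, $M_{\delta,\nu}$ denotes a nonnegative random variable with Laplace transform $(1+s^{\delta})^{-\nu}$, $s\ge0$ (generalized Mittag-Leffler distribution). *)

(* Defs.v *)
From HB Require Import structures.
From mathcomp Require Import all_boot all_order all_algebra.
From mathcomp Require Import all_classical all_reals all_analysis.
Set Implicit Arguments. Unset Strict Implicit. Unset Printing Implicit Defensive.
Import Order.TTheory GRing.Theory Num.Theory.
Import numFieldNormedType.Exports.
Local Open Scope classical_set_scope.
Local Open Scope ring_scope.

(* N (a nat-valued r.v.) is independent of the whole sequence X 0, X 1, ...: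
   product rule for every event {N \in B} and every cylinder event
   {X 0 \in A 0, ..., X (m-1) \in A (m-1)} (these cylinders form a pi-system
   generating sigma(X 0, X 1, ...)). *)
Definition indep_nat_seq {d} {Omega : measurableType d} {R : realType}
  (P : probability Omega R) (N : Omega -> nat) (X : nat -> Omega -> R) : Prop :=
  forall (m : nat) (B : set nat) (A : nat -> set R),
    (forall i, measurable (A i)) ->
    P (N @^-1` B `&` \bigcap_(i in `I_m) (X i @^-1` A i)) =
    (P (N @^-1` B) * P (\bigcap_(i in `I_m) (X i @^-1` A i)))%E.

Definition cvg_in_prob_to_infty {d} {Omega : measurableType d} {R : realType}
  (P : probability Omega R) (N : nat -> Omega -> nat) : Prop :=
  forall K : nat, (fun n => P [set w | (N n w <= K)%N]) @ \oo --> 0%E.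

(* Weak convergence (convergence in distribution) of the r.v.'s Y n to a
   limit law given by its integration functional lim_int (f |-> E f(Limit)):
   E f(Y n) -> lim_int f for every bounded continuous f. *)
Definition cvg_dist {d} {Omega : measurableType d} {R : realType}
  (P : probability Omega R) (Y : nat -> Omega -> R)
  (lim_int : (R -> R) -> \bar R) : Prop :=
  forall f : R -> R, continuous f -> [bounded f x | x in setT] ->
    (fun n => \int[P]_w (f (Y n w))%:E)%E @ \oo --> lim_int f.

Definition law_int {R : realType} (mu : probability R R) (f : R -> R) : \bar R :=
  (\int[mu]_x (f x)%:E)%E.

Definition half_inv_law_int {R : realType} (rho : probability R R) (f : R -> R)
  : \bar R := (\int[rho]_x (f (2 * x)^-1)%:E)%E.

Definition Phi {R : realType} (x : R) : \bar R := normal_prob 0 1 `]-oo, x[.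

(* mu is the law of L_{alpha,nu}: its characteristic function
   int exp(itx) dmu(x) = int cos(tx) dmu + i int sin(tx) dmu equals
   (1+|t|^alpha)^(-nu) *)
Definition is_law_L {R : realType} (alpha nu : R) (mu : probability R R) : Prop :=
  forall t : R,
    (\int[mu]_x (cos (t * x))%:E)%E = ((1 + `|t| `^ alpha) `^ (- nu))%:E /\
    (\int[mu]_x (sin (t * x))%:E)%E = 0%E.

Definition is_law_M {R : realType} (delta nu : R) (rho : probability R R) : Prop :=
  rho [set` `]-oo, 0[%classic] = 0%E /\
  forall s : R, 0 <= s ->
    (\int[rho]_x (expR (- (s * x)))%:E)%E = ((1 + s `^ delta) `^ (- nu))%:E.

(* Main.v *)
Require Import Defs.
From HB Require Import structures.
From mathcomp Require Import all_boot all_order all_algebra.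
From mathcomp Require Import all_classical all_reals all_analysis.
From mathcomp Require Import measurable_realfun.
From mathcomp Require Import ring lra.
Import Order.TTheory GRing.Theory Num.Theory.
Import numFieldNormedType.Exports.
Local Open Scope classical_set_scope.
Local Open Scope ring_scope.
Set Implicit Arguments. Unset Strict Implicit. Unset Printing Implicit Defensive.

(** Write Z_k for the normalised statistic sigma sqrt(k) (T_k - theta) and
U_n = N_n / n, so that sigma sqrt(n) (T_{N_n} - theta) = Z_{N_n} / sqrt(U_n).
Since N_n is independent of the sample and large, Z_{N_n} behaves like a
standard normal variable independent of U_n, whence
E cos(t sigma sqrt(n) (T_{N_n} - theta) + c) - cos(c) E exp(- t^2 / (2 U_n)) -> 0
as soon as 1 / U_n is tight; the normal approximation is uniform over bounded
functions with a common Lipschitz constant, which is what makes the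
substitution of the random index legitimate.  Tightness follows from either
side of the equivalence.  As E exp(- t^2 M) = (1 + |t|^alpha)^(- nu) is both
the Laplace transform of M at t^2 and the characteristic function of L at t,
the theorem reduces to two continuity theorems: Levy's (the cosines generate
Gaussian kernels by averaging, and these smooth any compactly supported
function), and one for the transforms E exp(- s / (2 U)), which are the
moments of exp(- 1 / U) in [0, 1] and are handled by Bernstein polynomials. *)

(** The obstacle is that at [N n = k] a cosine of frequency [t] in the randomised statistic has
    frequency [t * sqrt (n / k)] in the normalised [S k], which is unbounded as [k / n] approaches
    0. Tightness caps this Lipschitz constant on an event of probability close to 1. When the
    statistic converges, tightness holds because a small [N n / n] would inflate a nondegenerate
    variable. When the ratio converges, it holds because the limit has no mass at 0: the transform
    of [M] vanishes at infinity, so [M] has no atom at 0, the one point that the convention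
    [0^-1 = 0] sends to 0. Both continuity theorems start from a limit known to be a probability, so
    no subsequence is extracted: a plateau that carries most of the limit mass also carries most of
    the mass of the approximants, and test functions of compact support suffice. A phase [c] in the
    cosines covers the sines and replaces complex exponentials. *)

(** * Bounded measurable functions and their expectations *)

(** Such functions are integrable under every probability, so real-valued expectations become linear
    and monotone with this single side condition, which is stable under the operations used
    below. *)
Definition bdm {d} {T : measurableType d} {R : realType} (f : T -> R) : Prop :=
  measurable_fun setT f /\ exists M : R, forall x, `|f x| <= M.

Section BoundedMeasurable.
Context d {T : measurableType d} {R : realType}.
Implicit Types f g : T -> R.

Lemma bdm_cst (c : R) : bdm (fun _ : T => c).
Proof. by split; [exact: measurable_cst|exists `|c|]. Qed.

Lemma bdmD f g : bdm f -> bdm g -> bdm (fun x => f x + g x).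
Proof.
move=> [mf [M Mf]] [mg [M' Mg]]; split; first exact: measurable_funD.
by exists (M + M') => x; apply: le_trans (ler_normD _ _) _; exact: lerD.
Qed.

Lemma bdmN f : bdm f -> bdm (fun x => - f x).
Proof.
move=> [mf [M Mf]]; split; first exact: measurableT_comp.
by exists M => x; rewrite normrN.
Qed.

Lemma bdmB f g : bdm f -> bdm g -> bdm (fun x => f x - g x).
Proof. by move=> bf bg; apply: bdmD => //; exact: bdmN. Qed.

Lemma bdmM f g : bdm f -> bdm g -> bdm (fun x => f x * g x).
Proof.
move=> [mf [M Mf]] [mg [M' Mg]]; split; first exact: measurable_funM.
by exists (M * M') => x; rewrite normrM; exact: ler_pM.
Qed.

Lemma bdm_norm f : bdm f -> bdm (fun x => `|f x|).
Proof.
move=> [mf [M Mf]]; split; first exact: measurableT_comp.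
by exists M => x; rewrite normr_id.
Qed.

Lemma bdm_comp d' (T' : measurableType d') (f : T' -> R) (g : T -> T') :
  bdm f -> measurable_fun setT g -> bdm (fun x => f (g x)).
Proof.
move=> [mf [M Mf]] mg; split; first exact: (measurableT_comp mf mg).
by exists M => x; exact: Mf.
Qed.

Lemma bdm_indic (A : set T) : measurable A -> bdm (\1_A : T -> R).
Proof.
move=> mA; split; first exact: measurable_indic.
by exists 1 => x; rewrite indicE ger0_norm // lern1 leq_b1.
Qed.

Lemma bdm_cos f (c : R) :
  measurable_fun setT f -> bdm (fun x => cos (f x + c)).
Proof.
move=> mf; split; last first.
  by exists 1 => x; rewrite ler_norml cos_geN1 cos_le1.
apply: (@measurableT_comp _ _ _ _ _ _ (cos : R -> R)).
  by apply: continuous_measurable_fun; exact: continuous_cos.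
exact: measurable_funD.
Qed.

End BoundedMeasurable.

Lemma continuous_bdm {R : realType} (f : R -> R) :
  continuous f -> [bounded f x | x in setT] -> bdm f.
Proof.
move=> cf [M [Mr Mf]]; split; first exact: continuous_measurable_fun.
by exists (M + 1) => x; apply: Mf => //; rewrite ltrDl.
Qed.

Section Expectation.
Context d {T : measurableType d} {R : realType} (P : probability T R).
Implicit Types f g : T -> R.

Lemma bdm_integrable f : bdm f -> P.-integrable setT (EFin \o f).
Proof.
move=> [mf [M Mf]]; apply: (@le_integrable _ _ _ P setT measurableT _ (cst M%:E)).
- exact/measurable_EFinP.
- move=> x _; rewrite /= lee_fin; apply: le_trans (Mf x) _; exact: ler_norm.
- exact: finite_measure_integrable_cst.
Qed.

Lemma EFin_bdm f : bdm f -> (\int[P]_x f x)%:E = (\int[P]_x (f x)%:E)%E.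
Proof.
by move=> bf; rewrite /Rintegral fineK //; apply: integrable_fin_num => //;
  exact: bdm_integrable.
Qed.

Lemma ExpD f g : bdm f -> bdm g ->
  \int[P]_x (f x + g x) = \int[P]_x f x + \int[P]_x g x.
Proof. by move=> bf bg; apply: RintegralD => //; exact: bdm_integrable. Qed.

Lemma ExpB f g : bdm f -> bdm g ->
  \int[P]_x (f x - g x) = \int[P]_x f x - \int[P]_x g x.
Proof. by move=> bf bg; apply: RintegralB => //; exact: bdm_integrable. Qed.

Lemma ExpZ (c : R) f : bdm f -> \int[P]_x (c * f x) = c * \int[P]_x f x.
Proof. by move=> bf; apply: RintegralZl => //; exact: bdm_integrable. Qed.

Lemma Exp_cst (c : R) : \int[P]_(x in setT) c = c.
Proof. have P1 : P setT = 1%E by exact: probability_setT.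
transitivity (c * fine (P setT)); first exact: Rintegral_cst.
by rewrite P1 mulr1. Qed.

Lemma Exp_le f g : bdm f -> bdm g -> (forall x, f x <= g x) ->
  \int[P]_x f x <= \int[P]_x g x.
Proof. by move=> bf bg fg; apply: le_Rintegral => //; exact: bdm_integrable. Qed.

Lemma Exp_norm_le f g : bdm f -> bdm g -> (forall x, `|f x| <= g x) ->
  `|\int[P]_x f x| <= \int[P]_x g x.
Proof.
move=> bf bg fg; apply: le_trans (le_normr_Rintegral _ (bdm_integrable _)) _ => //.
by apply: Exp_le => //; exact: bdm_norm.
Qed.

Lemma Exp_dist_le f g (e : R) : bdm f -> bdm g -> (forall x, `|f x - g x| <= e) ->
  `|\int[P]_x f x - \int[P]_x g x| <= e.
Proof.
move=> bf bg fg; rewrite -ExpB // -[leRHS]Exp_cst.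
by apply: Exp_norm_le => //; [exact: bdmB|exact: bdm_cst].
Qed.

Lemma Exp_indic (A : set T) : measurable A -> \int[P]_x \1_A x = fine (P A).
Proof. by move=> mA; rewrite /Rintegral integral_indic // setIT. Qed.

Lemma Exp_cvg (f_ : nat -> T -> R) f (M : R) :
  (forall n, measurable_fun setT (f_ n)) ->
  (forall n x, `|f_ n x| <= M) ->
  (forall x, f_ ^~ x @ \oo --> f x) ->
  (fun n => \int[P]_x f_ n x) @ \oo --> \int[P]_x f x.
Proof.
move=> mf_ fM cf.
have mf : measurable_fun setT f.
  by apply: (measurable_fun_cvg mf_) => x _; exact: cf.
apply: fine_cvg; rewrite EFin_bdm; last first.
  split=> //; exists M => x.
  have /cvg_norm h := cf x; rewrite -(cvg_lim _ h) //.
  by apply: limr_le; [apply/cvg_ex; eexists; exact: h|exact: nearW].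
case: (@dominated_convergence _ _ _ P setT measurableT
  (fun n x => (f_ n x)%:E) (fun x => (f x)%:E) (cst M%:E)) => [|||||_ _ h];
  last exact: h.
- by move=> n; exact/measurable_EFinP.
- exact/measurable_EFinP.
- by apply: aeW => x _; apply: cvg_EFin; [exact: nearW|exact: cf].
- exact: finite_measure_integrable_cst.
- by apply: aeW => x n _; rewrite lee_fin.
Qed.

End Expectation.

(** * Fubini's theorem for bounded functions *)

Section FubiniBounded.
Context d1 d2 {T1 : measurableType d1} {T2 : measurableType d2} {R : realType}
  (P : probability T1 R) (Q : probability T2 R).
Variable f : T1 * T2 -> R.
Hypothesis bf : bdm f.

Let bf1 x : bdm (fun y => f (x, y)).
Proof. by apply: bdm_comp bf _; exact: measurable_pair1. Qed.

Let bf2 y : bdm (fun x => f (x, y)).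
Proof. by apply: bdm_comp bf _; exact: measurable_pair2. Qed.

Let intf : (P \x Q)%E.-integrable setT (EFin \o f).
Proof.
case: bf => mf [M Mf].
apply: (@le_integrable _ _ _ _ setT measurableT _ (cst M%:E)).
- exact/measurable_EFinP.
- move=> x _; rewrite /= lee_fin; apply: le_trans (Mf x) _; exact: ler_norm.
- apply/integrableP; split; first exact: measurable_cst.
  rewrite /= integral_cst //= -setXTT product_measure1E //=.
  have -> : P setT = 1%E by exact: probability_setT.
  have -> : Q setT = 1%E by exact: probability_setT.
  by rewrite !mule1 ltry.
Qed.

Lemma bdm_Exp1 : bdm (fun x => \int[Q]_y f (x, y)).
Proof.
split.
  apply/measurable_EFinP.
  rewrite (_ : _ \o _ = fubini_F Q (EFin \o f)); first exact: (measurable_fubini_F intf).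
  by apply/funext => x; rewrite /= EFin_bdm.
case: bf => mf [M Mf]; exists M => x; rewrite -[leRHS](Exp_cst Q).
by apply: Exp_norm_le => //; exact: bdm_cst.
Qed.

Lemma bdm_Exp2 : bdm (fun y => \int[P]_x f (x, y)).
Proof.
split.
  apply/measurable_EFinP.
  rewrite (_ : _ \o _ = fubini_G P (EFin \o f)); first exact: (measurable_fubini_G intf).
  by apply/funext => x; rewrite /= EFin_bdm.
case: bf => mf [M Mf]; exists M => x; rewrite -[leRHS](Exp_cst P).
by apply: Exp_norm_le => //; exact: bdm_cst.
Qed.

Lemma Exp_Fubini :
  \int[P]_x (\int[Q]_y f (x, y)) = \int[Q]_y (\int[P]_x f (x, y)).
Proof.
apply: EFin_inj; rewrite !EFin_bdm; [|exact: bdm_Exp2|exact: bdm_Exp1].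
under eq_integral do rewrite EFin_bdm //.
under [RHS]eq_integral do rewrite EFin_bdm //.
exact: (Fubini intf).
Qed.

End FubiniBounded.

(* The limit law is that of [Z] under [Q]. *)
Definition cvgE {d} {T : measurableType d} {d'} {T' : measurableType d'}
  {R : realType} (P : probability T R) (Y : nat -> T -> R)
  (Q : probability T' R) (Z : T' -> R) (f : R -> R) : Prop :=
  (fun n => \int[P]_w f (Y n w)) @ \oo --> \int[Q]_w f (Z w).

(** * Convergence of expectations: linearity, uniform limits, averages *)

Section CvgE.
Context d {T : measurableType d} d' {T' : measurableType d'} {R : realType}.
Variables (P : probability T R) (Y : nat -> T -> R).
Variables (Q : probability T' R) (Z : T' -> R).
Hypotheses (mY : forall n, measurable_fun setT (Y n)) (mZ : measurable_fun setT Z).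
Local Notation cv := (cvgE P Y Q Z).

Lemma cvgE_cst c : cv (fun _ => c).
Proof.
rewrite /cvgE (Exp_cst Q).
rewrite (_ : (fun n => _) = fun=> c); first exact: cvg_cst.
by apply/funext => n; exact: Exp_cst.
Qed.

Lemma cvgED f g : bdm f -> bdm g -> cv f -> cv g -> cv (fun x => f x + g x).
Proof.
move=> bf bg cf cg; rewrite /cvgE ExpD; [|exact: bdm_comp..].
have E n : \int[P]_w (f (Y n w) + g (Y n w)) =
    \int[P]_w f (Y n w) + \int[P]_w g (Y n w) by rewrite ExpD //; exact: bdm_comp.
by under eq_fun do rewrite E; exact: cvgD.
Qed.

Lemma cvgEZ c f : bdm f -> cv f -> cv (fun x => c * f x).
Proof.
move=> bf cf; rewrite /cvgE ExpZ; [|exact: bdm_comp..].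
have E n : \int[P]_w (c * f (Y n w)) = c * \int[P]_w f (Y n w).
  by rewrite ExpZ //; exact: bdm_comp.
under eq_fun do rewrite E.
by apply: cvgM => //; exact: cvg_cst.
Qed.

Lemma cvgE_approx f : bdm f ->
  (forall e : R, 0 < e -> exists g, [/\ bdm g, cv g & forall x, `|f x - g x| <= e]) ->
  cv f.
Proof.
move=> bf H; apply/cvgrPdist_le => e e0.
have [|g [bg cg fg]] := H (e / 3); first by rewrite divr_gt0.
have /cvgrPdist_le/(_ (e / 3)) := cg; rewrite divr_gt0 // => /(_ isT).
apply: filterS => n hn.
have h1 := @Exp_dist_le _ _ _ Q _ _ (e / 3) (bdm_comp bf mZ) (bdm_comp bg mZ)
  (fun x => fg (Z x)).
have h2 := @Exp_dist_le _ _ _ P _ _ (e / 3) (bdm_comp bf (mY n))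
  (bdm_comp bg (mY n)) (fun x => fg (Y n x)).
move: h1 h2 hn; rewrite !ler_norml; lra.
Qed.

(** Fubini moves the average over [s] outside the expectation, and bounded convergence passes to the
    limit under [G]. In this way cosines generate Gaussian kernels, and the kernels generate
    smoothed functions. *)
Lemma cvgE_average d2 (S : measurableType d2) (G : probability S R)
    (phi : R * S -> R) : bdm phi ->
  (forall s, cv (fun x => phi (x, s))) -> cv (fun x => \int[G]_s phi (x, s)).
Proof.
move=> bphi cphi; rewrite /cvgE.
have mp d0 (U : measurableType d0) (W : U -> R) : measurable_fun setT W ->
    bdm (fun z : U * S => phi (W z.1, z.2)).
  move=> mW; apply: (@bdm_comp _ _ _ _ _ phi _ bphi).
  by apply/measurable_fun_pair => //=; exact: measurableT_comp.
have FE n : \int[P]_w (\int[G]_s phi (Y n w, s)) =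
    \int[G]_s (\int[P]_w phi (Y n w, s)).
  exact: (Exp_Fubini _ _ (mp _ _ _ (mY n))).
under eq_fun do rewrite FE.
rewrite (Exp_Fubini _ _ (mp _ _ _ mZ)) /=.
case: (bphi) => _ [M Mphi].
apply: (@Exp_cvg _ _ _ _ _ _ M) => /=.
- by move=> n; have [] := bdm_Exp2 P _ (mp _ _ _ (mY n)).
- move=> n s; rewrite -[leRHS](Exp_cst P).
  apply: Exp_norm_le => //; last exact: bdm_cst.
  by apply: (bdm_comp (g := fun x => (x, s)) (mp _ _ _ (mY n))); exact: measurable_pair2.
- by move=> s; exact: cphi.
Qed.

End CvgE.

(** * The characteristic function of the normal law *)

Import HBNNSimple.

Section GaussianIntegrals.
Context {R : realType}.
Local Notation leb := (@lebesgue_measure R).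

Lemma nnsfun_integral_normal_prob (m s : R) (f : {nnsfun _ >-> R}) :
  (\int[normal_prob m s]_x (f x)%:E =
   \int[leb]_x ((f x)%:E * (normal_pdf m s x)%:E))%E.
Proof.
rewrite integralT_nnsfun sintegralE.
rewrite [RHS](_ : _ = \int[leb]_x (\sum_(r \in range f)
    ((r * \1_(f @^-1` [set r]) x)%:E * (normal_pdf m s x)%:E)))%E; last first.
  apply: eq_integral => x _; rewrite {1}fimfunE -fsumEFin // ge0_mule_fsuml //.
  by move=> r; exact: nnfun_muleindic_ge0.
rewrite ge0_integral_fsum //; last 2 first.
- move=> r; apply: emeasurable_funM.
    exact/measurable_EFinP/measurableT_comp.
  by apply/measurable_EFinP; exact: measurable_normal_pdf.
- move=> r x _; apply: mule_ge0; first exact: nnfun_muleindic_ge0.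
  by rewrite lee_fin normal_pdf_ge0.
apply: eq_fsbigr => r; rewrite inE => -[x _ fxr].
under [RHS]eq_integral do rewrite EFinM -muleA.
rewrite ge0_integralZl //=; last 3 first.
- apply: emeasurable_funM; first exact/measurable_EFinP/measurable_indic.
  by apply/measurable_EFinP; exact: measurable_normal_pdf.
- by move=> y _; rewrite mule_ge0 // lee_fin normal_pdf_ge0.
- by rewrite lee_fin -fxr.
congr (_ * _)%E; rewrite /normal_prob [LHS]integral_mkcond.
apply: eq_integral => y _; rewrite patchE indicE.
by case: ifPn => _; rewrite ?mul1e ?mul0e.
Qed.

(** Monotone convergence on both sides extends the density formula from simple functions. *)
Lemma ge0_integral_normal_prob (m s : R) (f : _ -> \bar R) :
  measurable_fun setT f -> (forall x, 0 <= f x)%E ->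
  (\int[normal_prob m s]_x f x = \int[leb]_x (f x * (normal_pdf m s x)%:E))%E.
Proof.
move=> mf f0; pose f_ := nnsfun_approx measurableT mf.
have mp : measurable_fun setT (fun x => (normal_pdf m s x)%:E).
  by apply/measurable_EFinP; exact: measurable_normal_pdf.
transitivity (lim (\int[normal_prob m s]_x (f_ n x)%:E @[n --> \oo])%E).
  rewrite -monotone_convergence//=.
  - apply: eq_integral => ? /[!inE] xD; apply/esym/cvg_lim => //=.
    exact: cvg_nnsfun_approx.
  - by move=> n; exact/measurable_EFinP/measurable_funTS.
  - by move=> n ? _; rewrite lee_fin.
  - by move=> ? _ ? ? mn; rewrite lee_fin; exact/lefP/nd_nnsfun_approx.
transitivity (lim (\int[leb]_x ((f_ n x)%:E * (normal_pdf m s x)%:E)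
    @[n --> \oo])%E).
  by apply: congr_lim; apply/funext => n /=; exact: nnsfun_integral_normal_prob.
rewrite -monotone_convergence//=.
- apply: eq_integral => x _; apply/cvg_lim => //=.
  by apply: cvgeMr => //; exact: cvg_nnsfun_approx.
- by move=> n; apply: emeasurable_funM => //; exact/measurable_EFinP/measurable_funTS.
- by move=> n ? _; rewrite mule_ge0 // lee_fin // normal_pdf_ge0.
- move=> x _ ? ? mn; apply: lee_wpmul2r; first by rewrite lee_fin normal_pdf_ge0.
  by rewrite lee_fin; exact/lefP/nd_nnsfun_approx.
Qed.

Lemma integrable_bdm_normal_pdf (m s : R) (f : R -> R) : bdm f ->
  leb.-integrable setT (fun x => (f x * normal_pdf m s x)%:E).
Proof.
move=> [mf [M Mf]].
apply: (@le_integrable _ _ _ leb setT measurableT _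
  (fun x => (M%:E * (normal_pdf m s x)%:E)%E)).
- apply/measurable_EFinP; apply: measurable_funM => //.
  exact: measurable_normal_pdf.
- move=> x _; rewrite -(EFinM M) /= lee_fin !normrM ler_wpM2r //.
  by apply: le_trans (Mf x) _; exact: ler_norm.
- by apply: integrableZl => //; exact: integrable_normal_pdf.
Qed.

Lemma Exp_normal_prob (m s : R) (f : R -> R) : bdm f ->
  \int[normal_prob m s]_x f x = \int[leb]_x (f x * normal_pdf m s x).
Proof.
move=> bf; have [mf [M Mf]] := bf.
(* Adding the bound [M] makes the integrand nonnegative, so that the previous lemma applies; the
   shift is removed at the end because the density has mass 1. *)
have h : \int[normal_prob m s]_x (f x + M) =
    \int[leb]_x ((f x + M) * normal_pdf m s x).
  rewrite /Rintegral ge0_integral_normal_prob.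
  - by congr fine; apply: eq_integral => x _; rewrite EFinM.
  - by apply/measurable_EFinP; exact: measurable_funD.
  - by move=> x; rewrite lee_fin -lerBlDr sub0r; have := Mf x; rewrite ler_norml => /andP[].
rewrite ExpD // in h; last exact: bdm_cst.
rewrite Exp_cst in h; apply: (addIr M); rewrite h.
under eq_Rintegral do rewrite mulrDl.
rewrite RintegralD //; [|exact: integrable_bdm_normal_pdf|]; last first.
  by apply: (@integrable_bdm_normal_pdf _ _ (fun=> M)); exact: bdm_cst.
congr (_ + _); rewrite RintegralZl //; last exact: integrable_normal_pdf.
by rewrite /Rintegral integral_normal_pdf mulr1.
Qed.

End GaussianIntegrals.

Definition stdnormal {R : realType} : probability (measurableTypeR R) R :=
  normal_prob (0 : R) 1.

Section GaussianFourier.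
Context {R : realType}.
Local Notation leb := (@lebesgue_measure R).
Local Notation p := (normal_pdf (0 : R) 1).

Lemma is_derive_affine (a c x : R) : is_derive x 1 (fun x : R => a * x + c) a.
Proof.
apply: is_derive_eq (_ : a *: 1 + 0 = a); last by rewrite addr0 [LHS]mulr1.
Qed.

Lemma is_derive_cos_affine (a c x : R) :
  is_derive x 1 (fun x : R => cos (a * x + c)) (- sin (a * x + c) * a).
Proof.
exact: (@is_derive1_comp _ cos (fun x => a * x + c) x _ _ _ (is_derive_affine a c x)).
Qed.

Lemma is_derive_sin_affine (a c x : R) :
  is_derive x 1 (fun x : R => sin (a * x + c)) (cos (a * x + c) * a).
Proof.
exact: (@is_derive1_comp _ sin (fun x => a * x + c) x _ _ _ (is_derive_affine a c x)).
Qed.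

Lemma std_normal_pdfE (x : R) : p x = normal_peak 1 * expR (- (x ^+ 2 / 2)).
Proof.
rewrite normal_pdfE ?oner_eq0 // /normal_fun subr0 expr1n mulNr.
by rewrite -[1 *+ 2]/(2%:R).
Qed.

Lemma is_derive_expR_sqr (k x : R) :
  is_derive x 1 (fun x : R => expR (k * x ^+ 2)) (expR (k * x ^+ 2) * (2 * k * x)).
Proof.
apply: (@is_derive1_comp _ expR (fun x => k * x ^+ 2) x).
have h : is_derive x 1 (fun x : R => x ^+ 2) (2 * x).
  have h := is_deriveM (is_derive_id x 1) (is_derive_id x 1).
  rewrite (_ : (fun x => _) = id * id); last by apply/funext => y; rewrite expr2.
  by apply: is_derive_eq h _; rewrite /GRing.scale /= mulr1 mulr_natl mulr2n.
apply: is_derive_eq (is_deriveZ k h) _.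
by rewrite /GRing.scale /=; ring.
Qed.

Lemma is_derive_std_normal_pdf (x : R) : is_derive x 1 p (- x * p x).
Proof.
rewrite (_ : p = fun x => normal_peak 1 * expR (- 2^-1 * x ^+ 2)); last first.
  by apply/funext => y; rewrite std_normal_pdfE; congr (_ * expR _); field.
have h := is_derive_expR_sqr (- 2^-1) x.
apply: is_derive_eq (is_deriveZ (normal_peak 1) h) _.
by rewrite /GRing.scale /=; field.
Qed.


Lemma continuous_cos_pdf (t c : R) : continuous (fun x => cos (t * x + c) * p x).
Proof.
move=> x; apply: cvgM; last exact: continuous_normal_pdf.
by apply: differentiable_continuous; apply/derivable1_diffP;
  have [] := is_derive_cos_affine t c x.
Qed.

Lemma derivable_LRcontinuous (f : R -> R) (a b : R) :
  (forall x, derivable f x 1) -> derivable_oo_LRcontinuous f a b.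
Proof.
move=> df; have cf x : {for x, continuous f}.
  exact/differentiable_continuous/derivable1_diffP/df.
split; first by move=> x _; exact: df.
- exact/cvg_at_right_filter/cf.
- exact/cvg_at_left_filter/cf.
Qed.

(** On a compact segment all integrands are continuous, so differentiation under the integral and
    integration by parts require no control at infinity. *)
Definition trunc_fourier (A c t : R) :=
  \int[leb]_(x in `[- A, A]) (cos (t * x + c) * p x).

(** Differentiating the cosine in [t] brings out the factor [- x * p x], which is the derivative of
    [p]. Integration by parts then returns the transform itself, up to the boundary terms at [A] and
    [- A]. *)
Lemma is_derive_trunc_fourier (A c t : R) : 0 < A ->
  is_derive t 1 (trunc_fourier A c)
    ((sin (t * A + c) - sin (- (t * A) + c)) * p A - t * trunc_fourier A c t).
Proof.
move=> A0.
have dcos (s x : R) : is_derive s 1 (fun s => cos (s * x + c) * p x)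
    (- (sin (s * x + c) * (x * p x))).
  have h : is_derive s 1 (fun s => cos (s * x + c)) (- sin (s * x + c) * x).
    have h := is_derive_cos_affine x c s.
    rewrite (_ : (fun s => _) = fun s => cos (x * s + c)); last first.
      by apply/funext => y; rewrite mulrC.
    by rewrite (mulrC s x).
  have h2 := is_deriveM h (is_derive_cst (p x) s 1).
  apply: is_derive_eq h2 _.
  by rewrite /GRing.scale /=; ring.
have ci s : leb.-integrable `[- A, A] (EFin \o (fun x => cos (s * x + c) * p x)).
  apply: continuous_compact_integrable; first exact: segment_compact.
  by apply: continuous_subspaceT; exact: continuous_cos_pdf.
pose f s x := cos (s * x + c) * p x.
have d1 s x : partial1of2 f s x = - (sin (s * x + c) * (x * p x)).
  by rewrite partial1of2E; have [_ <-] := dcos s x.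
have Ia : `]t - 1, t + 1[%classic t by rewrite /= in_itv /=; apply/andP; split; lra.
(* The constant [A * normal_peak 1] dominates the derivative: the sine is at most 1, [x] at most [A]
   in absolute value, and the density at most its peak. *)
have H := @cvg_differentiation_under_integral R _ _ leb f `[- A, A] (measurable_itv _)
  t (t - 1) (t + 1) Ia (fun s _ => ci s) (fun s x _ _ => @ex_derive _ _ _ _ _ _ _ (dcos s x))
  (cst (A * normal_peak 1)).
have E : \int[leb]_(x in `[- A, A]) partial1of2 f t x =
    (sin (t * A + c) - sin (- (t * A) + c)) * p A - t * trunc_fourier A c t.
  have H2 := @Rintegration_by_parts R (fun x => sin (t * x + c)) p
    (fun x => cos (t * x + c) * t) (fun x => - x * p x) (- A) A.
  have pA : p (- A) = p A by rewrite !std_normal_pdfE sqrrN.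
  under eq_Rintegral do rewrite d1 -mulrN -mulNr.
  rewrite H2.
  - rewrite pA mulrN -mulrBl; congr (_ - _).
    rewrite -RintegralZl //; apply: eq_Rintegral => x _; ring.
  - lra.
  - apply: continuous_subspaceT => x; apply: cvgM; last exact: cvg_cst.
    by apply: differentiable_continuous; apply/derivable1_diffP;
      have [] := is_derive_cos_affine t c x.
  - by apply: derivable_LRcontinuous => x; have [] := is_derive_sin_affine t c x.
  - by move=> x _; rewrite derive1E; have [_ ->] := is_derive_sin_affine t c x.
  - apply: continuous_subspaceT => x; apply: cvgM; last exact: continuous_normal_pdf.
    by apply: cvgN; exact: cvg_id.
  - by apply: derivable_LRcontinuous => x; have [] := is_derive_std_normal_pdf x.
  - by move=> x _; rewrite derive1E; have [_ ->] := is_derive_std_normal_pdf x.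
have {H} : h^-1 *: (trunc_fourier A c (h + t) - trunc_fourier A c t) @[h --> 0^'] -->
    \int[leb]_(x in `[- A, A]) partial1of2 f t x.
  apply: H.
  - by move=> y; apply: mulr_ge0; [exact: ltW|exact: normal_peak_ge0].
  - apply: continuous_compact_integrable; first exact: segment_compact.
    by apply: continuous_subspaceT => x; exact: cvg_cst.
  - move=> s x _; rewrite /= in_itv /= => xA; rewrite d1 normrN !normrM.
    rewrite -[leRHS]mul1r ler_pM // ?mulr_ge0 // ?ler_norml ?sin_geN1 ?sin_le1 //.
    apply: ler_pM => //; first by rewrite ler_norml.
    by rewrite ger0_norm ?normal_pdf_ge0 // normal_pdf_ub // oner_eq0.
rewrite E => H; apply: DeriveDef.
  by apply/cvg_ex; eexists; under eq_fun do rewrite scaler1; exact: H.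
by apply/cvg_lim => //; under eq_fun do rewrite scaler1; exact: H.
Qed.

(** The integrating factor cancels the term [- t * trunc_fourier A c t] of the derivative. What
    remains is a boundary term in which two sines give the factor 2, and the mean value theorem
    integrates it. *)
Lemma trunc_fourier_bound (A c t : R) : 0 < A -> 0 <= t ->
  `|expR (t ^+ 2 / 2) * trunc_fourier A c t - trunc_fourier A c 0| <=
  t * (expR (t ^+ 2 / 2) * (2 * p A)).
Proof.
move=> A0 t0; pose F s := expR (2^-1 * s ^+ 2) * trunc_fourier A c s.
pose dF s := expR (2^-1 * s ^+ 2) * ((sin (s * A + c) - sin (- (s * A) + c)) * p A).
have HF (s : R) : is_derive s 1 F (dF s).
  have h := is_deriveM (is_derive_expR_sqr 2^-1 s) (is_derive_trunc_fourier c s A0).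
  by apply: is_derive_eq h _; rewrite /GRing.scale /= /dF; field.
have cF : {within `[0, t], continuous F}.
  apply: continuous_subspaceT => s; apply: differentiable_continuous.
  by apply/derivable1_diffP; have [] := HF s.
have [s st E] := MVT_segment t0 (fun x _ => HF x) cF.
have -> : expR (t ^+ 2 / 2) * trunc_fourier A c t - trunc_fourier A c 0 = F t - F 0.
  by rewrite /F expr0n /= mulr0 expR0 mul1r (mulrC 2^-1).
rewrite E subr0 normrM (ger0_norm t0) mulrC ler_wpM2l //.
move: st; rewrite in_itv /= => /andP[s0 st].
rewrite /dF normrM ger0_norm ?expR_ge0 // ler_pM ?expR_ge0 //.
  by rewrite ler_expR mulrC ler_wpM2r // ler_sqr.
rewrite normrM (ger0_norm (normal_pdf_ge0 _ _ _)) ler_wpM2r ?normal_pdf_ge0 //.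
apply: le_trans (ler_normB _ _) _; rewrite -[2]/(1 + 1) lerD //;
  by rewrite ler_norml sin_geN1 sin_le1.
Qed.

Lemma trunc_fourier_cvg (c t : R) :
  (fun n : nat => trunc_fourier n.+1%:R c t) @ \oo -->
  \int[stdnormal]_x cos (t * x + c).
Proof.
pose I n : set R := `[- n.+1%:R, n.+1%:R]%classic.
have bI n : bdm (fun x : R => cos (t * x + c) * \1_(I n) x).
  by apply: bdmM; [apply: bdm_cos; exact: measurable_funM|
    apply: bdm_indic; exact: measurable_itv].
rewrite (_ : (fun n => _) =
    fun n => \int[stdnormal]_x (cos (t * x + c) * \1_(I n) x)); last first.
  apply/funext => n; rewrite [RHS](Exp_normal_prob _ _ (bI n)).
  rewrite /trunc_fourier Rintegral_mkcond; apply: eq_Rintegral => x _.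
  by rewrite patchE indicE; case: ifPn => _; rewrite ?mulr1 ?mulr0 ?mul0r.
apply: (@Exp_cvg _ _ _ _ _ _ 1).
- by move=> n; have [] := bI n.
- move=> n x; rewrite normrM -[leRHS]mulr1 ler_pM //.
    by rewrite ler_norml cos_geN1 cos_le1.
  by rewrite indicE ger0_norm // lern1 leq_b1.
- move=> x; apply: cvg_near_cst; near=> n.
  rewrite indicE (_ : x \in _ = true) ?mulr1 //.
  apply/mem_set; rewrite /I /= in_itv /= -ler_norml.
  near: n; exists (Num.trunc `|x|).+1 => // m /= xm.
  apply: le_trans (ltW (truncnS_gt _)) _.
  by rewrite ler_nat; exact: leq_trans xm (leqnSn _).
Unshelve. all: end_near. Qed.

Lemma std_normal_pdf_cvg0 : (fun n : nat => p n.+1%:R) @ \oo --> 0.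
Proof.
(* For [x >= 1] one has [expR (x ^+ 2 / 2) >= 1 + x ^+ 2 / 2 >= x / 2], whence the majorant
   [2 / x]. *)
apply: (@squeeze_cvgr _ _ _ _ (fun=> 0) (fun n => normal_peak 1 * 2 * n.+1%:R^-1)).
- apply: nearW => n; rewrite normal_pdf_ge0 /= std_normal_pdfE -mulrA.
  rewrite ler_wpM2l ?normal_peak_ge0 // expRN.
  rewrite -[2 in leRHS]invrK -invfM lef_pV2 ?posrE ?expR_gt0 ?mulr_gt0 //; last first.
  apply: le_trans (expR_ge1Dx _).
  rewrite mulrC ler_wpDl // ler_wpM2r // expr2 ler_peMl // ?ler1n //.
- exact: cvg_cst.
- rewrite -[X in _ --> X](mulr0 (normal_peak 1 * 2)).
  by apply: cvgM; [exact: cvg_cst|exact: cvg_harmonic].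
Qed.

(* The truncated transforms F_A satisfy (e^{t^2/2} F_A)' = O(p(A)), since
   p' = - x p; the boundary terms vanish as A grows. *)
Lemma fourier_stdnormal (t c : R) :
  \int[stdnormal]_x cos (t * x + c) = cos c * expR (- (t ^+ 2 / 2)).
Proof.
(* The cosine is even, so [(t, c)] may be replaced by [(- t, - c)]; the truncated bound is available
   for [t >= 0]. *)
wlog t0 : t c / 0 <= t => [H|].
  have [/H //|/ltW t0] := leP 0 t.
  have := H (- t) (- c); rewrite oppr_ge0 cosN sqrrN => <- //.
  by apply: eq_Rintegral => x _; rewrite -cosN mulNr -opprD.
have h0 : \int[stdnormal]_x cos (0 * x + c) = cos c.
  rewrite -[RHS](Exp_cst stdnormal); apply: eq_Rintegral => x _.
  by rewrite mul0r add0r.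
have L : `|expR (t ^+ 2 / 2) * \int[stdnormal]_x cos (t * x + c) -
     \int[stdnormal]_x cos (0 * x + c)| <= 0.
  have c1 : (fun n : nat => `|expR (t ^+ 2 / 2) * trunc_fourier n.+1%:R c t -
      trunc_fourier n.+1%:R c 0|) @ \oo -->
      `|expR (t ^+ 2 / 2) * \int[stdnormal]_x cos (t * x + c) -
        \int[stdnormal]_x cos (0 * x + c)|.
    apply: cvg_norm; apply: cvgB; last exact: trunc_fourier_cvg.
    by apply: cvgM; [exact: cvg_cst|exact: trunc_fourier_cvg].
  have c2 : (fun n : nat => t * (expR (t ^+ 2 / 2) * (2 * p n.+1%:R))) @ \oo --> 0.
    rewrite -[X in _ --> X](mulr0 t); apply: cvgM; first exact: cvg_cst.
    rewrite -[X in _ --> X](mulr0 (expR (t ^+ 2 / 2))); apply: cvgM; first exact: cvg_cst.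
    rewrite -[X in _ --> X](mulr0 2); apply: cvgM; first exact: cvg_cst.
    exact: std_normal_pdf_cvg0.
  apply: (ler_cvg_to c1 c2); apply: nearW => n; exact: trunc_fourier_bound.
move: L; rewrite h0 normr_le0 subr_eq0 => /eqP <-.
by rewrite mulrC mulrA -expRD addNr expR0 mul1r.
Qed.

End GaussianFourier.

(** * Continuous cutoffs and uniform continuity *)

(** The maximum of [u] and 0, written with the absolute value so that its continuity is that of the
    norm. *)
Definition pos_part {R : realType} (u : R) : R := (u + `|u|) / 2.

Section PosPart.
Context {R : realType}.
Implicit Types u x : R.

Lemma pos_part_ge0 u : 0 <= pos_part u.
Proof. by rewrite /pos_part; have := ler_norm (- u); rewrite normrN; lra. Qed.

Lemma pos_part_id u : 0 <= u -> pos_part u = u.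
Proof. by move=> u0; rewrite /pos_part ger0_norm //; field. Qed.

Lemma pos_part0 u : u <= 0 -> pos_part u = 0.
Proof. by move=> u0; rewrite /pos_part ler0_norm // subrr mul0r. Qed.

Lemma pos_part_le u v : u <= v -> 0 <= v -> pos_part u <= v.
Proof.
by move=> uv v0; have [/pos_part_id ->|/ltW/pos_part0 ->] := leP 0 u.
Qed.

Lemma continuous_pos_part (f : R -> R) :
  continuous f -> continuous (fun x => pos_part (f x)).
Proof.
move=> cf x; apply: cvgM; last exact: cvg_cst.
by apply: cvgD; [exact: cf|apply: cvg_norm; exact: cf].
Qed.

(** A trapezoid: 1 on [[- A, A]], then linear down to 0 over one unit on either side. *)
Definition plateau (A x : R) : R := pos_part (1 - pos_part (`|x| - A)).

Lemma plateau_ge0 A x : 0 <= plateau A x. Proof. exact: pos_part_ge0. Qed.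

Lemma plateau_le1 A x : plateau A x <= 1.
Proof. by apply: pos_part_le => //; have := pos_part_ge0 (`|x| - A); lra. Qed.

Lemma plateau1 A x : `|x| <= A -> plateau A x = 1.
Proof.
by move=> xA; rewrite /plateau (@pos_part0 (`|x| - A)) ?subr0 ?pos_part_id //; lra.
Qed.

Lemma plateau0 A x : A + 1 <= `|x| -> plateau A x = 0.
Proof.
by move=> xA; rewrite /plateau (@pos_part_id (`|x| - A)) ?pos_part0 //; lra.
Qed.

Lemma continuous_plateau A : continuous (plateau A).
Proof.
apply: continuous_pos_part => x; apply: cvgB; first exact: cvg_cst.
apply: (@continuous_pos_part (fun x => `|x| - A)) => {}x.
by apply: cvgB; [apply: cvg_norm; exact: cvg_id|exact: cvg_cst].
Qed.

Lemma bdm_bounded_continuous (f : R -> R) (M : R) :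
  continuous f -> (forall x, `|f x| <= M) -> bdm f.
Proof. by move=> cf fM; split; [exact: continuous_measurable_fun|exists M]. Qed.

Lemma bdm_plateau A : bdm (plateau A).
Proof.
apply: (@bdm_bounded_continuous _ 1); first exact: continuous_plateau.
by move=> x; rewrite ger0_norm ?plateau_ge0 ?plateau_le1.
Qed.

Lemma cc_unif_continuous (f : R -> R) (A e : R) : continuous f ->
  (forall x, A <= `|x| -> f x = 0) -> 0 < e ->
  exists2 delta, 0 < delta & forall x y, `|x - y| < delta -> `|f x - f y| <= e.
Proof.
move=> cf f0 e0.
have H (x : R) : \forall x' \near x & i \near 0^'+,
    forall y, `|x' - y| < i -> `|f x' - f y| <= e.
  have /cvgrPdist_lt/(_ (e / 2)) := cf x.
  rewrite divr_gt0 // => /(_ isT) /nbhs_ballP[r /= r0 Hr].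
  exists (ball x (r / 2), [set d | d < r / 2]).
    by split; [apply: nbhsx_ballx; rewrite divr_gt0|apply: nbhs_right_lt; rewrite divr_gt0].
  move=> [x' dl] /= []; rewrite -ball_normE /= => xx' dr y x'y.
  have h1 : `|f x - f x'| < e / 2 by apply: Hr; rewrite -ball_normE /=; lra.
  have h2 : `|f x - f y| < e / 2.
    apply: Hr; rewrite -ball_normE /=.
    by have := ler_distD x' x y; lra.
  by have := ler_distD (f x) (f x') (f y); rewrite (distrC (f x') (f x)); lra.
(* The segment exceeds the support by 1 and [dl] is kept below 1: if [x] lies outside the segment,
   then both [x] and [y] lie where [f] vanishes. *)
have /compact_near_coveringP/(_ R (0^'+) (fun d x =>
  forall y, `|x - y| < d -> `|f x - f y| <= e) _ (fun x _ => H x)) Hn :=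
  @segment_compact R (- (A + 1)) (A + 1).
near (0:R)^'+ => dl.
have dl0 : 0 < dl by near: dl; exact: nbhs_right_gt.
have dl1 : dl < 1 by near: dl; exact: nbhs_right_lt.
have Hdl : `[- (A + 1), A + 1] `<=`
    (fun x => forall y, `|x - y| < dl -> `|f x - f y| <= e) by near: dl.
exists dl => // x y xy.
have [xA|xA] := leP `|x| (A + 1).
  by apply: Hdl => //=; rewrite in_itv /= -ler_norml.
have := ler_distD y x 0; rewrite !subr0 => ?.
by rewrite !f0 ?subrr ?normr0 ?ltW //; lra.
Unshelve. all: end_near. Qed.

End PosPart.

(** * Reduction to test functions of compact support *)

Section CompactSupportSuffices.
Context d {T : measurableType d} d' {T' : measurableType d'} {R : realType}.
Variables (P : probability T R) (Y : nat -> T -> R).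
Variables (Q : probability T' R) (Z : T' -> R).
Hypotheses (mY : forall n, measurable_fun setT (Y n)) (mZ : measurable_fun setT Z).
Local Notation cv := (cvgE P Y Q Z).

Lemma Exp_plateau_cvg : (fun n : nat => \int[Q]_w plateau n%:R (Z w)) @ \oo --> (1 : R).
Proof.
rewrite -[X in _ --> X](Exp_cst Q 1); apply: (@Exp_cvg _ _ _ _ _ _ 1).
- by move=> n; have [] := bdm_comp (bdm_plateau n%:R) mZ.
- by move=> n x; rewrite ger0_norm ?plateau_ge0 ?plateau_le1.
- move=> x; apply: cvg_near_cst; near=> n; apply: plateau1.
  near: n; exists (Num.trunc `|Z x|).+1 => // m /= xm.
  by apply: le_trans (ltW (truncnS_gt _)) _; rewrite ler_nat.
Unshelve. all: end_near. Qed.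

(** No mass escapes to infinity: a plateau that carries nearly all the mass of [Z] is itself an
    admissible test function, so it carries nearly all the mass of [Y n] for large [n]. The part of
    [f] that it cuts off is then negligible on both sides. *)
Lemma cvgE_compact_support :
  (forall (f : R -> R) (A M : R), continuous f -> (forall x, A <= `|x| -> f x = 0) ->
     (forall x, `|f x| <= M) -> cv f) ->
  forall (f : R -> R) (M : R), continuous f -> (forall x, `|f x| <= M) -> cv f.
Proof.
move=> H f M cf fM; apply/cvgrPdist_le => /= e e0.
have M0 : 0 <= M by apply: le_trans (fM 0).
(* Cutting off costs [M * eta] for the limit and [2 * M * eta] for [Y n], that is at most [e / 2]
   together, and the compactly supported part costs [e / 6]. The summand 1 keeps the denominator
   positive. *)
pose eta := e / (6 * (M + 1)).
have eta0 : 0 < eta by rewrite divr_gt0 // mulr_gt0 //; lra.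
have etaM : 6 * (M * eta) <= e.
  have : eta * (6 * (M + 1)) = e by rewrite divfK // gt_eqF // mulr_gt0 //; lra.
  by rewrite (_ : eta * _ = 6 * (M * eta) + 6 * eta); [lra|ring].
have /cvgrPdist_le/(_ _ eta0)[A _ /(_ A (leqnn A)) hA] := Exp_plateau_cvg.
pose chi := plateau (A%:R : R).
have bchi : bdm chi by exact: bdm_plateau.
have bf : bdm f by exact: bdm_bounded_continuous fM.
have c1 : cv chi.
  apply: (H chi (A%:R + 1) 1); [exact: continuous_plateau|exact: plateau0|].
  by move=> x; rewrite ger0_norm ?plateau_ge0 ?plateau_le1.
have c2 : cv (fun x => f x * chi x).
  apply: (H _ (A%:R + 1) M).
  - by move=> x; apply: cvgM; [exact: cf|exact: continuous_plateau].
  - by move=> x xA; rewrite /chi plateau0 ?mulr0.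
  - move=> x; rewrite normrM -[leRHS]mulr1 ler_pM //.
    by rewrite ger0_norm ?plateau_ge0 ?plateau_le1.
have B d0 (U : measurableType d0) (G : probability U R) (W : U -> R) :
    measurable_fun setT W ->
    `|\int[G]_w f (W w) - \int[G]_w (f (W w) * chi (W w))| <=
    M * (1 - \int[G]_w chi (W w)).
  move=> mW; have bfW := bdm_comp bf mW; have bcW := bdm_comp bchi mW.
  rewrite -ExpB //; last exact: bdmM.
  rewrite -{1}(Exp_cst G 1) -ExpB //; last exact: bdm_cst.
  rewrite -ExpZ; last by apply: bdmB => //; exact: bdm_cst.
  apply: Exp_norm_le.
  - by apply: bdmB => //; exact: bdmM.
  - by apply: bdmM; [exact: bdm_cst|apply: bdmB => //; exact: bdm_cst].
  - move=> w; rewrite -{1}[f (W w)]mulr1 -mulrBr normrM.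
    rewrite [`|1 - _|]ger0_norm ?subr_ge0 ?plateau_le1 //.
    by rewrite ler_wpM2r // subr_ge0 plateau_le1.
have {}c1 : \forall n \near \oo,
    `|\int[Q]_w chi (Z w) - \int[P]_w chi (Y n w)| <= eta.
  by move/cvgrPdist_le: c1; apply.
have {}c2 : \forall n \near \oo, `|\int[Q]_w (f (Z w) * chi (Z w)) -
    \int[P]_w (f (Y n w) * chi (Y n w))| <= e / 6.
  by move/cvgrPdist_le: c2; apply; rewrite divr_gt0.
near=> n.
have hn1 : `|\int[Q]_w chi (Z w) - \int[P]_w chi (Y n w)| <= eta by near: n.
have hn2 : `|\int[Q]_w (f (Z w) * chi (Z w)) -
    \int[P]_w (f (Y n w) * chi (Y n w))| <= e / 6 by near: n.
have b1 := B _ _ Q _ mZ; have b2 := B _ _ P _ (mY n).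
have d1 : M * (1 - \int[Q]_w chi (Z w)) <= M * eta.
  by rewrite ler_wpM2l //; move: hA; rewrite ler_norml => /andP[].
have d2 : M * (1 - \int[P]_w chi (Y n w)) <= M * (eta + eta).
  by rewrite ler_wpM2l //; move: hA hn1; rewrite !ler_norml /chi; lra.
move: b1 b2 hn2; rewrite !ler_norml; lra.
Unshelve. all: end_near. Qed.

End CompactSupportSuffices.

(** * Levy's continuity theorem *)

Section GaussianKernel.
Context {R : realType}.
Local Notation leb := (@lebesgue_measure R).

Lemma normal_pdf_exp (x s y : R) : 0 < s ->
  normal_pdf x s y = normal_peak s * expR (- (((x - y) / s) ^+ 2 / 2)).
Proof.
move=> s0; rewrite normal_pdfE ?gt_eqF // /normal_fun; congr (_ * expR _).
by rewrite -mulr_natr; field; rewrite gt_eqF.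
Qed.

Lemma normal_peak_double (s : R) : 0 < s -> normal_peak s = 2 * normal_peak (2 * s).
Proof.
move=> s0; rewrite /normal_peak.
have -> : (2 * s) ^+ 2 * pi *+ 2 = 2 ^+ 2 * (s ^+ 2 * pi *+ 2) by ring.
by rewrite [Num.sqrt (2 ^+ 2 * _)]sqrtrM ?sqr_ge0 // sqrtr_sqr ger0_norm // invfM mulVKf.
Qed.

Lemma expRN_le (u : R) : 0 < u -> expR (- u) <= u^-1.
Proof.
move=> u0; rewrite expRN lef_pV2 ?posrE ?expR_gt0 //.
by apply: le_trans (expR_ge1Dx _); lra.
Qed.

(* The density at [s] is at most a small multiple of the density at [2 s] away
   from the centre, so the tail is bounded without computing any moment. *)
Lemma normal_pdf_tail (x s y delta : R) : 0 < s -> 0 < delta -> delta <= `|x - y| ->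
  normal_pdf x s y <= 6 * (s / delta) ^+ 2 * normal_pdf x (2 * s) y.
Proof.
move=> s0 d0 dxy; rewrite !normal_pdf_exp ?mulr_gt0 // (normal_peak_double s0).
set k := normal_peak (2 * s); have k0 : 0 <= k by exact: normal_peak_ge0.
set u := ((x - y) / s) ^+ 2.
have -> : ((x - y) / (2 * s)) ^+ 2 = u / 4 by rewrite /u; field; rewrite gt_eqF.
(* The exponent [u / 8] belongs to the density at [2 * s]. The remaining factor
   [expR (- (3 * u / 8))] is at most [8 / (3 * u)], and with the factor 2 from the peaks this gives
   [16 / 3], rounded up to 6. *)
have -> : - (u / 2) = - (u * (3 / 8)) + - (u / 4 / 2) by field.
have ud : (delta / s) ^+ 2 <= u.
  rewrite /u -(real_normK (num_real ((x - y) / s))) ler_sqr ?nnegrE ?divr_ge0 //; try exact: ltW.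
  by rewrite normrM normfV (gtr0_norm s0) ler_wpM2r // invr_ge0 ltW.
have u0 : 0 < u by apply: lt_le_trans ud; rewrite exprn_gt0 // divr_gt0.
rewrite expRD (_ : _ * (_ * _) = 2 * expR (- (u * (3 / 8))) * (k * expR (- (u / 4 / 2))));
  last by ring.
rewrite ler_wpM2r ?mulr_ge0 ?expR_ge0 //.
apply: (@le_trans _ _ (2 * (u * (3 / 8))^-1)).
  by rewrite ler_wpM2l // expRN_le // mulr_gt0.
have : u^-1 <= (s / delta) ^+ 2.
  have -> : (s / delta) ^+ 2 = ((delta / s) ^+ 2)^-1 by rewrite -exprVn invf_div.
  by rewrite lef_pV2 ?posrE // exprn_gt0 // divr_gt0.
rewrite (_ : 2 * (u * (3 / 8))^-1 = 16 / 3 * u^-1); last by field; rewrite gt_eqF.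
have : 0 <= u^-1 by rewrite invr_ge0 ltW.
lra.
Qed.

Lemma measurable_dist_ge (x delta : R) : measurable [set y : R | delta <= `|x - y|].
Proof.
have mf : measurable_fun setT (fun y : R => `|x - y|).
  by apply: measurableT_comp => //; exact: measurable_funB.
rewrite (_ : [set y | _] = [set: R] `&` (fun y => `|x - y|) @^-1` `[delta, +oo[).
  by apply: mf => //; exact: measurable_itv.
by rewrite setTI; apply/seteqP; split => y; rewrite /= in_itv /= andbT.
Qed.

Lemma normal_prob_tail (x s delta : R) : 0 < s -> 0 < delta ->
  \int[normal_prob x s]_y \1_[set y : R | delta <= `|x - y|] y <= 6 * (s / delta) ^+ 2.
Proof.
move=> s0 d0; set c := 6 * _.
have c0 : 0 <= c by rewrite mulr_ge0 // sqr_ge0.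
have b1 : bdm (\1_[set y : R | delta <= `|x - y|] : R -> R).
  by apply: bdm_indic; exact: measurable_dist_ge.
rewrite (Exp_normal_prob _ _ b1).
rewrite -[leRHS](Exp_cst (normal_prob x (2 * s))) (Exp_normal_prob _ _ (bdm_cst c)).
apply: le_Rintegral => //.
- exact: integrable_bdm_normal_pdf.
- by apply: (@integrable_bdm_normal_pdf _ _ _ (fun=> c)); exact: bdm_cst.
move=> y _; rewrite indicE; have [|_] := boolP (_ \in _).
  by rewrite inE /= => h; rewrite mul1r; exact: normal_pdf_tail.
by rewrite mul0r mulr_ge0 // normal_pdf_ge0.
Qed.

End GaussianKernel.

Section LevyContinuity.
Context d {T : measurableType d} d' {T' : measurableType d'} {R : realType}.
Variables (P : probability T R) (Y : nat -> T -> R).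
Variables (Q : probability T' R) (Z : T' -> R).
Hypotheses (mY : forall n, measurable_fun setT (Y n)) (mZ : measurable_fun setT Z).
Local Notation cv := (cvgE P Y Q Z).
Hypothesis Hcos : forall t c, cv (fun x => cos (t * x + c)).

(** Up to the factor [normal_peak s], the kernel is the characteristic function of the standard
    normal law at [(x - y) / s], hence an average of cosines in [x] over a Gaussian frequency. *)
Lemma cvgE_normal_pdf (s y : R) : 0 < s -> cv (fun x => normal_pdf x s y).
Proof.
move=> s0.
pose phi (z : R * measurableTypeR R) := cos (z.2 * ((z.1 - y) / s) + 0).
have bphi : bdm phi.
  apply: bdm_cos; apply: measurable_funM => //.
  by apply: measurable_funM => //; apply: measurable_funB.
have E x : normal_pdf x s y = normal_peak s * \int[stdnormal]_t phi (x, t).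
  rewrite normal_pdf_exp //; congr (_ * _).
  have := @fourier_stdnormal R ((x - y) / s) 0; rewrite cos0 mul1r => <-.
  by apply: eq_Rintegral => t _; rewrite /phi /= mulrC.
rewrite (_ : (fun x => _) = fun x => normal_peak s * \int[stdnormal]_t phi (x, t));
  last exact/funext.
(* [bdm_Exp1] speaks of a product of two probabilities; the Dirac mass is an arbitrary choice for
   the first. *)
apply: cvgEZ => //; first exact: (bdm_Exp1 (\d_(0 : R)) stdnormal bphi).
apply: cvgE_average => // t.
rewrite (_ : (fun x => _) = fun x => cos ((t / s) * x + (- (t * y / s)))) //.
by apply/funext => x; rewrite /phi /=; congr cos; field; rewrite gt_eqF.
Qed.

(** Averages are taken under a probability, while smoothing integrates over Lebesgue measure.
    Dividing [f] by the standard normal density [p] turns the one into the other, and the compact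
    support of [f] keeps the quotient bounded. *)
Lemma cvgE_smoothed (f : R -> R) (A M s : R) : 0 < s -> measurable_fun setT f ->
  (forall x, A <= `|x| -> f x = 0) -> (forall x, `|f x| <= M) ->
  bdm (fun x => \int[normal_prob x s]_y f y) /\
  cv (fun x => \int[normal_prob x s]_y f y).
Proof.
move=> s0 mf f0 fM; pose p := normal_pdf (0 : R) 1.
have p0 y : 0 < p y.
  by rewrite /p std_normal_pdfE mulr_gt0 ?expR_gt0 // normal_peak_gt0 ?oner_eq0.
have bf : bdm f by split => //; exists M.
have M0 : 0 <= M by apply: le_trans (fM 0).
pose phi (z : R * measurableTypeR R) := f z.2 / p z.2 * normal_pdf z.1 s z.2.
have bw : bdm (fun y => f y / p y).
  split.
    apply: measurable_funM => //; apply: continuous_measurable_fun => x.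
    by apply: cvgV; [rewrite gt_eqF|exact: continuous_normal_pdf (oner_neq0 _) _].
  (* Where [f] may be nonzero, [|y| < A], and [p] decreases in [|y|], so [p A] bounds it from
     below. *)
  exists (M / p A) => y; rewrite normrM normfV (gtr0_norm (p0 y)).
  have [yA|yA] := leP A `|y|; first by rewrite f0 // normr0 mul0r divr_ge0 // ltW.
  apply: ler_pM => //; first by rewrite invr_ge0 ltW.
  rewrite lef_pV2 ?posrE // ltW //.
  rewrite /p !std_normal_pdfE ltr_pM2l ?normal_peak_gt0 ?oner_eq0 //.
  rewrite ltr_expR ltrN2 ltr_pM2r // -(real_normK (num_real y)) ltr_sqr ?nnegrE //.
  by apply: le_trans (ltW yA).
have bk : bdm (fun z : R * measurableTypeR R => normal_pdf z.1 s z.2).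
  split.
    rewrite (_ : (fun z => _) = fun z : R * measurableTypeR R =>
      normal_peak s * expR (- (((z.1 - z.2) / s) ^+ 2 / 2))); last first.
      by apply/funext => z; rewrite normal_pdf_exp.
    apply: measurable_funM => //; apply: measurableT_comp => //.
    apply: measurableT_comp => //; apply: measurable_funM => //.
    apply: measurable_funX; apply: measurable_funM => //.
    by apply: measurable_funB.
  by exists (normal_peak s) => z; rewrite ger0_norm ?normal_pdf_ge0 // normal_pdf_ub // gt_eqF.
have bphi : bdm phi.
  by apply: bdmM => //; apply: (bdm_comp bw).
have E x : \int[normal_prob x s]_y f y = \int[stdnormal]_y phi (x, y).
  have bx : bdm (fun y => phi (x, y)).
    by apply: (bdm_comp (g := fun y => (x, y)) bphi); exact: measurable_pair1.
  rewrite (Exp_normal_prob _ _ bf) [RHS](Exp_normal_prob _ _ bx).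
  by apply: eq_Rintegral => y _; rewrite /phi /= -/p mulrAC divfK // gt_eqF.
rewrite (_ : (fun x => _) = fun x => \int[stdnormal]_y phi (x, y)); last exact/funext.
split; first exact: (bdm_Exp1 (\d_(0 : R)) stdnormal bphi).
apply: cvgE_average => // y; rewrite /phi /=.
apply: cvgEZ => //; last exact: cvgE_normal_pdf.
by apply: (bdm_comp (g := fun x => (x, y)) bk); exact: measurable_pair2.
Qed.

Lemma levy_compact_support (f : R -> R) (A M : R) : continuous f ->
  (forall x, A <= `|x| -> f x = 0) -> (forall x, `|f x| <= M) -> cv f.
Proof.
move=> cf f0 fM.
have mf : measurable_fun setT f by exact: continuous_measurable_fun.
have bf : bdm f by split => //; exists M.
have M0 : 0 <= M by apply: le_trans (fM 0).
apply: cvgE_approx => // e e0.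
have [dl dl0 Hdl] := @cc_unif_continuous _ f A (e / 2) cf f0 ltac:(lra).
(* The kernel of width [dl * r] has mass at most [6 * r ^+ 2] beyond distance [dl], where the error
   is at most [2 * M]. As [r <= 1], this part is at most [12 * M * r <= e / 2]; uniform continuity
   gives the other [e / 2]. *)
pose r := Num.min 1 (e / (24 * (M + 1))).
have r0 : 0 < r by rewrite lt_min ltr01 divr_gt0 // mulr_gt0 //; lra.
have r1 : r <= 1 by rewrite ge_min lexx.
have rM : 24 * (M * r) <= e.
  have : r * (24 * (M + 1)) <= e.
    by rewrite -ler_pdivlMr ?mulr_gt0 //; [rewrite ge_min lexx orbT|lra].
  by rewrite (_ : r * _ = 24 * (M * r) + 24 * r); [lra|ring].
have s0 : 0 < dl * r by rewrite mulr_gt0.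
have [bs cs] := cvgE_smoothed s0 mf f0 fM.
exists (fun x => \int[normal_prob x (dl * r)]_y f y); split => //.
move=> x; rewrite -[f x](Exp_cst (normal_prob x (dl * r))) -ExpB //; last exact: bdm_cst.
set D : set R := [set y | dl <= `|x - y|].
have bD : bdm (\1_D : R -> R) by apply: bdm_indic; exact: measurable_dist_ge.
apply: (@le_trans _ _ (\int[normal_prob x (dl * r)]_y (e / 2 + 2 * M * \1_D y))).
  apply: Exp_norm_le.
  - by apply: bdmB => //; exact: bdm_cst.
  - by apply: bdmD; [exact: bdm_cst|apply: bdmM => //; exact: bdm_cst].
  - move=> y; rewrite indicE; have [_|] := boolP (y \in D).
      have := ler_normB (f x) (f y); have := fM x; have := fM y; rewrite /=; lra.
    by rewrite notin_setE /D /= => /negP; rewrite -ltNge mulr0 addr0 => /Hdl.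
rewrite ExpD; [|exact: bdm_cst|by apply: bdmM => //; exact: bdm_cst].
rewrite (ExpZ _ (2 * M)) // [X in X + _ <= _](_ : _ = e / 2); last exact: Exp_cst.
have := normal_prob_tail x s0 dl0; rewrite -/D => h.
have {h} : 2 * M * (\int[normal_prob x (dl * r)]_y \1_D y) <=
    2 * M * (6 * (dl * r / dl) ^+ 2) by rewrite ler_wpM2l // mulr_ge0.
have -> : dl * r / dl = r by rewrite mulrAC divff ?mul1r // gt_eqF.
have : 2 * M * (6 * r ^+ 2) <= 12 * (M * r).
  rewrite (_ : 2 * M * _ = 12 * (M * r) * r); last by ring.
  by rewrite ler_piMr // mulr_ge0 // mulr_ge0 // ltW.
lra.
Qed.

Theorem levy_continuity (f : R -> R) (M : R) :
  continuous f -> (forall x, `|f x| <= M) -> cv f.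
Proof. exact: (cvgE_compact_support mY mZ levy_compact_support). Qed.

End LevyContinuity.

(** * Continuity theorem for the transforms of [psi] *)

Section Bernstein.
Context {R : realType}.
Implicit Types (f g : R -> R) (h x c : R).

(* [bern n h f x] is the expectation of [f (h S)] for [S] binomial [(n, x)]. *)
Fixpoint bern (n : nat) (h : R) (f : R -> R) (x : R) : R :=
  if n is m.+1 then x * bern m h (fun u => f (u + h)) x + (1 - x) * bern m h f x
  else f 0.

Lemma bern_le n h f g x : 0 <= x <= 1 -> (forall u, f u <= g u) ->
  bern n h f x <= bern n h g x.
Proof.
move=> /andP[x0 x1]; elim: n f g => [|n IH] f g fg //=.
by rewrite lerD // ler_wpM2l ?subr_ge0 // IH.
Qed.

Lemma bern_affine n h f a b x :
  bern n h (fun u => a + b * f u) x = a + b * bern n h f x.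
Proof.
elim: n f => [|n IH] f //=.
by have /= -> := IH (fun u => f (u + h)); rewrite IH; ring.
Qed.

(** Squared bias plus binomial variance. The centre [c] is arbitrary because the shift by [h] in the
    recursion moves it to [c - h]. *)
Lemma bern_sqr n h c x : bern n h (fun u => (u - c) ^+ 2) x =
  (n%:R * h * x - c) ^+ 2 + n%:R * h ^+ 2 * (x * (1 - x)).
Proof.
elim: n c => [|n IH] c /=; first by ring.
rewrite (_ : (fun u => (u + h - c) ^+ 2) = fun u => (u - (c - h)) ^+ 2); last first.
  by apply/funext => u; congr (_ ^+ 2); ring.
by rewrite !IH -natr1; ring.
Qed.

Lemma bern_poly n h f : exists p : {poly R}, forall x, bern n h f x = p.[x].
Proof.
elim: n f => [|n IH] f; first by exists (f 0)%:P => x; rewrite hornerC.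
have [p Hp] := IH (fun u => f (u + h)); have [q Hq] := IH f.
by exists ('X * p + (1 - 'X) * q) => x /=; rewrite Hp Hq !hornerE.
Qed.

(** Bernstein's argument: uniform continuity and the bound on [g] give
    [|g u - g x| <= e / 2 + K * (u - x) ^+ 2], and the Bernstein mean of the square about [x] is at
    most [1 / n]. *)
Lemma weierstrass (g : R -> R) (A M e : R) : continuous g ->
  (forall x, A <= `|x| -> g x = 0) -> (forall x, `|g x| <= M) -> 0 < e ->
  exists p : {poly R}, forall x, 0 <= x <= 1 -> `|g x - p.[x]| <= e.
Proof.
move=> cg g0 gM e0.
have [dl dl0 Hdl] := @cc_unif_continuous _ g A (e / 2) cg g0 ltac:(lra).
have M0 : 0 <= M by apply: le_trans (gM 0).
pose K := 2 * M / dl ^+ 2.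
have K0 : 0 <= K by rewrite divr_ge0 ?sqr_ge0 ?mulr_ge0.
pose n := (Num.trunc (2 * K / e)).+1.
have nK : K / n%:R <= e / 2.
  rewrite ler_pdivrMr ?ltr0n //.
  have : 2 * K / e < n%:R by exact: truncnS_gt.
  by rewrite ltr_pdivrMr //; lra.
have [p Hp] := bern_poly n n%:R^-1 g; exists p => x x01; rewrite -Hp.
have B u : `|g u - g x| <= e / 2 + K * (u - x) ^+ 2.
  have [ux|ux] := ltP `|u - x| dl.
    by apply: le_trans (Hdl _ _ ux) _; rewrite lerDl mulr_ge0 ?sqr_ge0.
  apply: (@le_trans _ _ (2 * M)).
    by have := ler_normB (g u) (g x); have := gM u; have := gM x; lra.
  apply: (@le_trans _ _ (K * (u - x) ^+ 2)); last by rewrite lerDr; lra.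
  rewrite -(real_normK (num_real (u - x))) /K mulrAC ler_pdivlMr ?exprn_gt0 //.
  by rewrite ler_wpM2l ?mulr_ge0 // ler_sqr ?nnegrE // ltW.
have S : bern n n%:R^-1 (fun u => (u - x) ^+ 2) x <= n%:R^-1.
  have n0 : n%:R != 0 :> R by rewrite pnatr_eq0.
  rewrite bern_sqr mulfV // mul1r subrr expr0n add0r.
  have -> : n%:R * n%:R^-1 ^+ 2 = n%:R^-1 :> R by field.
  rewrite ler_piMr ?invr_ge0 //.
  by case/andP: x01; nra.
have KS : K * bern n n%:R^-1 (fun u => (u - x) ^+ 2) x <= K / n%:R by rewrite ler_wpM2l.
have up : bern n n%:R^-1 g x <= (g x + e / 2) + K * bern n n%:R^-1 (fun u => (u - x) ^+ 2) x.
  rewrite -bern_affine; apply: bern_le => // u.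
  by have := B u; rewrite ler_norml; lra.
have lo : (g x - e / 2) + (- K) * bern n n%:R^-1 (fun u => (u - x) ^+ 2) x <= bern n n%:R^-1 g x.
  rewrite -bern_affine; apply: bern_le => // u.
  by have := B u; rewrite ler_norml; lra.
by rewrite ler_norml; move: up lo KS nK; rewrite mulNr; lra.
Qed.

End Bernstein.

(* [psi (t ^+ 2) u] is the expectation of [cos (t Z / sqrt u)] for [Z] standard
   normal, extended by its limit 0 to [u <= 0]. *)
Definition psi {R : realType} (s u : R) : R :=
  if 0 < u then expR (- (s / (2 * u))) else 0.

Section Psi.
Context {R : realType}.
Implicit Types s u : R.

Lemma psi_gt0 s u : 0 < u -> psi s u = expR (- (s / (2 * u))).
Proof. by rewrite /psi => ->. Qed.

Lemma psi_le0 s u : u <= 0 -> psi s u = 0.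
Proof. by rewrite /psi ltNge => ->. Qed.

Lemma psi01 s u : 0 <= s -> 0 <= psi s u <= 1.
Proof.
move=> s0; rewrite /psi; case: ifPn => [u0|_]; last by rewrite lexx ler01.
rewrite expR_ge0 /= -expR0 ler_expR oppr_le0 divr_ge0 // mulr_ge0 //; exact: ltW.
Qed.

(** Polynomials in [psi 2] are thus combinations of functions whose expectations converge by
    hypothesis. The exponent is a successor because the power 0 is 1 even for [u <= 0]. *)
Lemma psi2X u n : psi 2 u ^+ n.+1 = psi (2 * n.+1%:R) u.
Proof.
rewrite /psi; case: ifPn => _; last by rewrite expr0n.
by rewrite -expRM_natl; congr expR; ring.
Qed.

Lemma continuous_psi s : 0 < s -> continuous (psi s).
Proof.
move=> s0 u; rewrite /continuous_at; have [u0|u0|u0] := ltgtP 0 u.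
- have : (fun v => expR (- (s / (2 * v)))) v @[v --> u] --> psi s u.
    rewrite psi_gt0 //; apply: continuous_cvg; first exact: continuous_expR.
    apply: cvgN; apply: cvgM; first exact: cvg_cst.
    apply: cvgV; first by rewrite gt_eqF // mulr_gt0.
    by apply: cvgM; [exact: cvg_cst|exact: cvg_id].
  apply: cvg_trans; apply: near_eq_cvg; near=> v; rewrite psi_gt0 //.
  by near: v; exact: lt_nbhsr.
- rewrite (psi_le0 s (ltW u0)); apply: cvg_near_cst; near=> v; apply: psi_le0.
  by apply: ltW; near: v; exact: lt_nbhsl.
(* To the right of 0, the bound [expR (- x) <= 1 / x] gives [psi s v <= 2 * v / s]. *)
- rewrite -u0 (psi_le0 s (lexx 0)); apply/cvgrPdist_le => /= e e0; near=> v.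
  rewrite sub0r normrN ger0_norm; last by case/andP: (psi01 v (ltW s0)).
  have [v0|v0] := leP v 0; first by rewrite psi_le0 // ltW.
  rewrite psi_gt0 //; apply: (@le_trans _ _ (s / (2 * v))^-1).
    by apply: expRN_le; rewrite divr_gt0 // mulr_gt0.
  rewrite invf_div ler_pdivrMr //.
  have : `|0 - v| < e * s / 2.
    near: v; apply: cvgr_dist_lt; first exact: cvg_id.
    by rewrite divr_gt0 // mulr_gt0.
  by rewrite sub0r normrN gtr0_norm //; lra.
Unshelve. all: end_near. Qed.

Lemma bdm_psi s : 0 < s -> bdm (psi s).
Proof.
move=> s0; apply: (@bdm_bounded_continuous _ _ 1); first exact: continuous_psi.
by move=> u; have /andP[a b] := psi01 u (ltW s0); rewrite ger0_norm.
Qed.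

(* Inverts [psi 2] on the compactly supported [f]: [g (psi 2 u) = f u] for [u >= 0]. *)
Lemma psi2_factor (f : R -> R) (A : R) : continuous f ->
  (forall x, A <= `|x| -> f x = 0) ->
  exists g : R -> R, [/\ continuous g, forall v, exists u, g v = f u \/ g v = 0 &
    forall u, 0 <= u -> g (psi 2 u) = f u].
Proof.
(* Since [psi 2 u = expR (- u^-1)] for [u > 0], the inverse is [- (ln v)^-1]. For [v <= 0] the
   conventions [ln v = 0] and [0^-1 = 0] yield [f 0], the continuous extension. As [v] tends to 1
   from below the argument goes to infinity: beyond [expR (- B^-1)] it exceeds [B >= A] and [f]
   vanishes. *)
move=> cf f0; pose g v := if v < 1 then f (- (ln v)^-1) else 0.
pose B := Num.max A 1; have B0 : 0 < B by rewrite lt_max ltr01 orbT.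
have AB : A <= B by rewrite le_max lexx.
have g1 v : expR (- B^-1) < v -> g v = 0.
  move=> vB; rewrite /g; case: ifPn => // v1; apply: f0.
  have v0 : 0 < v by apply: lt_trans vB; exact: expR_gt0.
  have l0 : ln v < 0 by rewrite ln_lt0 // v0.
  rewrite normrN normfV ltr0_norm // (le_trans AB) // -[leLHS]invrK.
  rewrite lef_pV2 ?posrE ?invr_gt0 ?oppr_gt0 // lerNl -[leLHS]expRK ler_ln ?posrE ?expR_gt0 //.
  exact: ltW.
have g0 v : v <= 0 -> g v = f 0.
  by move=> v0; rewrite /g (le_lt_trans v0 ltr01) ln0 // invr0 oppr0.
exists g; split.
- move=> v; rewrite /continuous_at; have [v0|v0|->] := ltgtP v 0.
  + rewrite (g0 _ (ltW v0)); apply: cvg_near_cst; near=> w; apply: g0.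
    by apply: ltW; near: w; exact: lt_nbhsl.
  + have [v1|v1] := ltP v 1; last first.
      have h : expR (- B^-1) < v.
        by apply: lt_le_trans v1; rewrite -expR0 ltr_expR oppr_lt0 invr_gt0.
      rewrite (g1 _ h); apply: cvg_near_cst; near=> w; apply: g1.
      by near: w; exact: lt_nbhsr.
    have l0 : ln v < 0 by rewrite ln_lt0 // v0.
    have : (fun w => f (- (ln w)^-1)) w @[w --> v] --> g v.
      rewrite /g v1; apply: (cvg_comp (fun w => - (ln w)^-1) f); last exact: cf.
      by apply: cvgN; apply: cvgV; [rewrite lt_eqF|exact: continuous_ln].
    apply: cvg_trans; apply: near_eq_cvg; near=> w; rewrite /g ifT //.
    by near: w; exact: lt_nbhsl.
  + rewrite (g0 _ (lexx 0)); apply/cvgrPdist_le => /= e e0.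
    have /cvgrPdist_le/(_ _ e0)/nbhs_ballP[r /= r0 Hr] := cf 0.
    near=> w; have [w0|w0] := leP w 0; first by rewrite g0 // subrr normr0 ltW.
    have wr : w < expR (- r^-1).
      have : `|0 - w| < expR (- r^-1).
        by near: w; apply: cvgr_dist_lt; [exact: cvg_id|exact: expR_gt0].
      by rewrite sub0r normrN gtr0_norm.
    have l0 : ln w < - r^-1 by rewrite -[ltRHS]expRK ltr_ln ?posrE ?expR_gt0.
    have ri : 0 < r^-1 by rewrite invr_gt0.
    rewrite /g ifT; last first.
      by apply: lt_trans wr _; rewrite -expR0 ltr_expR oppr_lt0.
    apply: Hr; rewrite -ball_normE /= sub0r normrN normrN normfV ltr0_norm; last lra.
    by rewrite -[ltRHS]invrK ltf_pV2 ?posrE //; lra.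
- by move=> v; rewrite /g; case: ifPn => _; [exists (- (ln v)^-1); left|exists 0; right].
- move=> u; rewrite le_eqVlt => /predU1P[<-|u0].
    by rewrite psi_le0 // g0.
  rewrite psi_gt0 // /g ifT; last first.
    by rewrite -expR0 ltr_expR oppr_lt0 divr_gt0 // mulr_gt0.
  by rewrite expRK; congr f; field; rewrite gt_eqF.
Unshelve. all: end_near. Qed.

End Psi.

Section LaplaceContinuity.
Context d {T : measurableType d} d' {T' : measurableType d'} {R : realType}.
Variables (P : probability T R) (Y : nat -> T -> R).
Variables (Q : probability T' R) (Z : T' -> R).
Hypotheses (mY : forall n, measurable_fun setT (Y n)) (mZ : measurable_fun setT Z).
Hypotheses (Y0 : forall n w, 0 <= Y n w) (Z0 : forall w, 0 <= Z w).
Local Notation cv := (cvgE P Y Q Z).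
Hypothesis Hpsi : forall s, 0 < s -> cv (psi s).

Lemma cvgE_psi_poly (p : {poly R}) :
  bdm (fun u => p.[psi 2 u]) /\ cv (fun u => p.[psi 2 u]).
Proof.
have b2 : bdm (psi 2 : R -> R) by exact: bdm_psi.
have bX n : bdm (fun u : R => psi 2 u ^+ n) /\ cv (fun u => psi 2 u ^+ n).
  case: n => [|n]; first by split; [exact: bdm_cst|exact: cvgE_cst].
  rewrite (_ : (fun u => _) = psi (2 * n.+1%:R)); last by apply/funext => u; exact: psi2X.
  by split; [apply: bdm_psi|apply: Hpsi]; rewrite mulr_gt0.
rewrite (_ : (fun u => _) = fun u => \sum_(i < size p) p`_i * psi 2 u ^+ i); last first.
  by apply/funext => u; rewrite horner_coef.
elim: (size p) => [|n [IHb IHc]].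
  rewrite (_ : (fun u => _) = fun=> 0); last by apply/funext => u; rewrite big_ord0.
  by split; [exact: bdm_cst|exact: cvgE_cst].
rewrite (_ : (fun u => _) = fun u => \sum_(i < n) p`_i * psi 2 u ^+ i + p`_n * psi 2 u ^+ n);
  last by apply/funext => u; rewrite big_ord_recr.
have [bn cn] := bX n.
have bZ : bdm (fun u : R => p`_n * psi 2 u ^+ n) by apply: bdmM => //; exact: bdm_cst.
split; first exact: bdmD.
by apply: cvgED => //; exact: cvgEZ.
Qed.

Lemma laplace_compact_support (f : R -> R) (A M : R) : continuous f ->
  (forall x, A <= `|x| -> f x = 0) -> (forall x, `|f x| <= M) -> cv f.
Proof.
move=> cf f0 fM; have M0 : 0 <= M by apply: le_trans (fM 0).
have [g [cg gf gK]] := psi2_factor cf f0.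
have gM v : `|g v| <= M.
  by have [u [->|->]] := gf v; [exact: fM|rewrite normr0].
(* [g] takes the value [f 0] on the whole negative half-line. The plateau gives it the compact
   support that [weierstrass] asks for and leaves it unchanged on [[0, 1]], where [psi 2] takes its
   values. *)
pose G v := g v * plateau 1 v.
have cG : continuous G by move=> v; apply: cvgM; [exact: cg|exact: continuous_plateau].
have GM v : `|G v| <= M.
  rewrite normrM -[leRHS]mulr1 ler_pM //.
  by rewrite ger0_norm ?plateau_ge0 ?plateau_le1.
have G0 v : 1 + 1 <= `|v| -> G v = 0 by move=> h; rewrite /G plateau0 ?mulr0.
have GK u : 0 <= u -> G (psi 2 u) = f u.
  move=> u0; have /andP[p0 p1] := @psi01 R 2 u ltac:(lra).
  by rewrite /G gK // plateau1 ?mulr1 // ger0_norm.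
have bG : bdm (fun u => G (psi 2 u)).
  by apply: (bdm_comp (bdm_bounded_continuous cG GM)); have [] := @bdm_psi R 2 ltac:(lra).
suff : cv (fun u => G (psi 2 u)).
  rewrite /cvgE; under [in X in X -> _]eq_fun do (under eq_Rintegral do rewrite GK //).
  by under [in X in X -> _]eq_Rintegral do rewrite GK //.
apply: cvgE_approx => // e e0.
have [p Hp] := weierstrass cG G0 GM e0.
have [bp cp] := cvgE_psi_poly p.
by exists (fun u => p.[psi 2 u]); split => // u; apply: Hp; apply: psi01; lra.
Qed.

Theorem laplace_continuity (f : R -> R) (M : R) :
  continuous f -> (forall x, `|f x| <= M) -> cv f.
Proof. exact: (cvgE_compact_support mY mZ laplace_compact_support). Qed.

End LaplaceContinuity.

(** * From distribution functions to Lipschitz functions *)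

Definition below {R : realType} (x y : R) : R := (y < x)%R%:R.

Lemma belowE {R : realType} (x : R) : below x = \1_(`]-oo, x[%classic).
Proof. by apply/funext => y; rewrite indicE mem_setE in_itv. Qed.

Lemma bdm_below {R : realType} (x : R) : bdm (below x).
Proof. by rewrite belowE; apply: bdm_indic; exact: measurable_itv. Qed.

Section CdfLipschitz.
Context d {T : measurableType d} d' {T' : measurableType d'} {R : realType}.
Variables (P : probability T R) (S : nat -> T -> R).
Variables (Q : probability T' R) (Z : T' -> R).
Hypotheses (mS : forall n, measurable_fun setT (S n)) (mZ : measurable_fun setT Z).
Local Notation cv := (cvgE P S Q Z).
Hypothesis Hcdf : forall x : R, cv (below x).

Variables (x0 eta : R).
Hypothesis eta0 : 0 < eta.
Let x i := x0 + i%:R * eta.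
Let cell i y := below (x i.+1) y - below (x i) y.

Let bcell i : bdm (cell i).
Proof. by apply: bdmB; exact: bdm_below. Qed.

Let x_lt i : x i < x i.+1.
Proof. by rewrite /x -natr1 mulrDl mul1r ltrD2l ltrDl. Qed.

Let cell_cases i y : (cell i y = 0) \/ (cell i y = 1 /\ x i <= y < x i.+1).
Proof.
rewrite /cell /below; have [yx|yx] := ltP y (x i).
  by left; rewrite (lt_trans yx (x_lt i)) subrr.
by have [yx'|_] := ltP y (x i.+1); [right; rewrite subr0|left; rewrite subrr].
Qed.

Let sum_cell m y : \sum_(i < m) cell i y = below (x m) y - below (x 0) y.
Proof.
elim: m => [|m IH]; first by rewrite big_ord0 subrr.
by rewrite big_ord_recr /= IH /cell; ring.
Qed.

Let step m (h : R -> R) y := \sum_(i < m) h (x i) * cell i y.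

Let bdm_sum m (F : nat -> R -> R) : (forall i, bdm (F i)) ->
  bdm (fun y => \sum_(i < m) F i y).
Proof.
move=> bF; elim: m => [|m IH].
  rewrite (_ : (fun y => _) = fun=> 0); first exact: bdm_cst.
  by apply/funext => y; rewrite big_ord0.
rewrite (_ : (fun y => _) = fun y => \sum_(i < m) F i y + F m y); first exact: bdmD.
by apply/funext => y; rewrite big_ord_recr.
Qed.

(** Within the grid, [y] is at most [eta] away from the left end of its cell; outside it the step
    function is 0 and [|h|] is at most 1. *)
Let step_approx m (h : R -> R) (C y : R) : (forall y, `|h y| <= 1) ->
  (forall u v, `|h u - h v| <= C * `|u - v|) -> 0 <= C ->
  `|h y - step m h y| <= C * eta + (1 - (below (x m) y - below (x 0) y)).
Proof.
move=> h1 hC C0; rewrite -sum_cell.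
have c0 i : 0 <= cell i y by have [->|[->]] := cell_cases i y.
have s0 : 0 <= \sum_(i < m) cell i y by apply: sumr_ge0.
have s1 : \sum_(i < m) cell i y <= 1.
  by rewrite sum_cell /below; case: (y < x m); case: (y < x 0) => /=; lra.
have -> : h y - step m h y = h y * (1 - \sum_(i < m) cell i y) +
    \sum_(i < m) (h y - h (x i)) * cell i y.
  rewrite mulrBr mulr1 mulr_sumr /step -addrA; congr (_ + _).
  by rewrite -!sumrN -big_split /=; apply: eq_bigr => i _; ring.
apply: le_trans (ler_normD _ _) _; rewrite addrC lerD //; last first.
  rewrite normrM [`|1 - _|]ger0_norm ?subr_ge0 // ler_piMl ?subr_ge0 //.
apply: le_trans (ler_norm_sum _ _ _) _.
apply: (@le_trans _ _ (\sum_(i < m) C * eta * cell i y)); last first.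
  by rewrite -mulr_sumr ler_piMr // mulr_ge0 // ltW.
apply: ler_sum => i _; rewrite normrM (ger0_norm (c0 i)).
have [->|[-> /andP[yx1 yx2]]] := cell_cases i y; first by rewrite !mulr0.
rewrite !mulr1; apply: le_trans (hC _ _) _; rewrite ler_wpM2l //.
rewrite ger0_norm ?subr_ge0 //; move: yx2.
by rewrite /x -natr1 mulrDl mul1r; move: (_ * eta) => a; lra.
Qed.

Let Exp_step d1 (U : measurableType d1) (G : probability U R) (W : U -> R) m h :
  measurable_fun setT W ->
  \int[G]_w step m h (W w) = \sum_(i < m) h (x i) * \int[G]_w cell i (W w).
Proof.
move=> mW; rewrite /step; elim: m => [|m IH].
  rewrite big_ord0 -[RHS](Exp_cst G); apply: eq_Rintegral => w _; exact: big_ord0.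
rewrite big_ord_recr /= -IH -ExpZ; last exact: bdm_comp.
rewrite -ExpD.
- by apply: eq_Rintegral => w _; rewrite big_ord_recr.
- apply: (@bdm_comp _ _ _ _ _ (fun y => \sum_(i < m) h (x i) * cell i y) W) => //.
  apply: (@bdm_sum m (fun i y => h (x i) * cell i y)) => i.
  by apply: bdmM => //; exact: bdm_cst.
- by apply: bdmM; [exact: bdm_cst|exact: bdm_comp].
Qed.

Let Exp_step_approx d1 (U : measurableType d1) (G : probability U R) (W : U -> R) m
    (h : R -> R) (C : R) :
  measurable_fun setT W -> measurable_fun setT h -> (forall y, `|h y| <= 1) ->
  (forall u v, `|h u - h v| <= C * `|u - v|) -> 0 <= C ->
  `|\int[G]_w h (W w) - \int[G]_w step m h (W w)| <=
  C * eta + (1 - (\int[G]_w below (x m) (W w) - \int[G]_w below (x 0) (W w))).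
Proof.
move=> mW mh h1 hC C0.
have bh : bdm h by split => //; exists 1.
have bs : bdm (step m h).
  apply: (@bdm_sum m (fun i y => h (x i) * cell i y)) => i.
  by apply: bdmM => //; exact: bdm_cst.
have b1 := bdm_comp (bdm_below (x m)) mW; have b0 := bdm_comp (bdm_below (x 0)) mW.
rewrite -ExpB; [|exact: bdm_comp bh mW|exact: bdm_comp bs mW].
rewrite -ExpB // -{1}(Exp_cst G 1) -ExpB; [|exact: bdm_cst|exact: bdmB].
rewrite -(Exp_cst G (C * eta)) -ExpD; [|exact: bdm_cst|by apply: bdmB; [exact: bdm_cst|exact: bdmB]].
apply: Exp_norm_le.
- by apply: bdmB; [exact: bdm_comp bh mW|exact: bdm_comp bs mW].
- by apply: bdmD; [exact: bdm_cst|apply: bdmB; [exact: bdm_cst|exact: bdmB]].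
- by move=> w; exact: step_approx.
Qed.

(** Only the finitely many grid values of the distribution functions enter the estimate, so the
    threshold on [k] is fixed before [h] is chosen. *)
Lemma lipschitz_grid_bound m (C e : R) : 0 < e -> 0 <= C ->
  \forall k \near \oo, forall h : R -> R, measurable_fun setT h ->
  (forall y, `|h y| <= 1) -> (forall u v, `|h u - h v| <= C * `|u - v|) ->
  `|\int[P]_w h (S k w) - \int[Q]_w h (Z w)| <=
  2 * (C * eta + (1 - (\int[Q]_w below (x m) (Z w) - \int[Q]_w below (x 0) (Z w)))) + e.
Proof.
move=> e0 C0.
have ccell i : cv (cell i).
  have := @cvgED _ _ _ _ _ P S Q Z mS mZ (below (x i.+1)) (fun y => -1 * below (x i) y).
  rewrite (_ : (fun y => below (x i.+1) y + _) = cell i); last first.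
    by apply/funext => y; rewrite /cell; ring.
  apply => //; first exact: bdm_below.
  - by apply: bdmM; [exact: bdm_cst|exact: bdm_below].
  - by apply: cvgEZ => //; exact: bdm_below.
have csum : \forall k \near \oo,
    \sum_(i < m) `|\int[P]_w cell i (S k w) - \int[Q]_w cell i (Z w)| <= e / 3.
  have : (fun k => \sum_(i < m) `|\int[P]_w cell i (S k w) - \int[Q]_w cell i (Z w)|)
      @ \oo --> (0 : R).
    elim: m => [|n]; first by under eq_fun do rewrite big_ord0; exact: cvg_cst.
    set F := (fun k => \sum_(i < n) _) => IH.
    rewrite (_ : (fun k => _) = fun k => F k +
        `|\int[P]_w cell n (S k w) - \int[Q]_w cell n (Z w)|); last first.
      by apply/funext => k; rewrite big_ord_recr.
    rewrite -[X in _ --> X]addr0; apply: cvgD => //.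
    rewrite -[X in _ --> X](@normr0 _ R); apply: cvg_norm.
    by apply/subr_cvg0; exact: ccell.
  move/cvgrPdist_le/(_ (e / 3)); rewrite divr_gt0 // => /(_ isT).
  apply: filterS => k; rewrite sub0r normrN ger0_norm //.
  by apply: sumr_ge0 => i _; exact: normr_ge0.
(* One third for the step functions, and one for each end of the grid, where the mass that [S k]
   leaves outside is compared with that of [Z]. *)
have e3 : 0 < e / 3 by rewrite divr_gt0.
have cb i : \forall k \near \oo,
    `|\int[Q]_w below (x i) (Z w) - \int[P]_w below (x i) (S k w)| <= e / 3.
  by move/cvgrPdist_le: (@Hcdf (x i)); apply.
have cm := cb m; have c0 := cb 0%N.
near=> k => h mh h1 hC.
have a1 := Exp_step_approx P m (mS k) mh h1 hC C0.
have a2 := Exp_step_approx Q m mZ mh h1 hC C0.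
have a3 : `|\int[P]_w step m h (S k w) - \int[Q]_w step m h (Z w)| <= e / 3.
  rewrite !Exp_step // -sumrB; apply: le_trans (ler_norm_sum _ _ _) _.
  apply: (@le_trans _ _ (\sum_(i < m) `|\int[P]_w cell i (S k w) - \int[Q]_w cell i (Z w)|)).
    by apply: ler_sum => i _; rewrite -mulrBr normrM ler_piMl.
  by near: k.
have a4 : `|\int[Q]_w below (x m) (Z w) - \int[P]_w below (x m) (S k w)| <= e / 3 by near: k.
have a5 : `|\int[Q]_w below (x 0) (Z w) - \int[P]_w below (x 0) (S k w)| <= e / 3 by near: k.
move: a1 a2 a3 a4 a5; rewrite !ler_norml; lra.
Unshelve. all: end_near. Qed.

End CdfLipschitz.

Section CdfLipschitzUniform.
Context d {T : measurableType d} d' {T' : measurableType d'} {R : realType}.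
Variables (P : probability T R) (S : nat -> T -> R).
Variables (Q : probability T' R) (Z : T' -> R).
Hypotheses (mS : forall n, measurable_fun setT (S n)) (mZ : measurable_fun setT Z).
Hypothesis Hcdf : forall x : R, cvgE P S Q Z (below x).

Lemma cdf_tight : (fun n : nat => \int[Q]_w (below n%:R (Z w)) -
    \int[Q]_w (below (- n%:R) (Z w))) @ \oo --> (1 : R).
Proof.
have mb (x : R) : bdm (fun w => below x (Z w)).
  exact: (bdm_comp (bdm_below x) mZ).
rewrite (_ : (fun n => _) = fun n : nat => \int[Q]_w (below n%:R (Z w) -
    below (- n%:R) (Z w))); last first.
  by apply/funext => n; rewrite ExpB.
rewrite -[X in _ --> X](Exp_cst Q 1); apply: (@Exp_cvg _ _ _ _ _ _ 1).
- by move=> n; have [] := bdmB (mb n%:R) (mb (- n%:R)).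
- move=> n w; rewrite /below.
  by case: (_ < _); case: (_ < _); rewrite /= ?subrr ?subr0 ?sub0r ?normrN ?normr0 ?normr1.
- move=> w; apply: cvg_near_cst; near=> n; rewrite /below.
  have wn : `|Z w| < n%:R.
    near: n; exists (Num.trunc `|Z w|).+1 => // m /= xm.
    by apply: lt_le_trans (truncnS_gt _) _; rewrite ler_nat.
  by move: wn; rewrite ltr_norml => /andP[h1 ->]; rewrite (ltNge (Z w)) (ltW h1) subr0.
Unshelve. all: end_near. Qed.

Lemma lipschitz_uniform (C e : R) : 0 < e -> 0 <= C ->
  \forall k \near \oo, forall h : R -> R, measurable_fun setT h ->
  (forall y, `|h y| <= 1) -> (forall u v, `|h u - h v| <= C * `|u - v|) ->
  `|\int[P]_w h (S k w) - \int[Q]_w h (Z w)| <= e.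
Proof.
move=> e0 C0.
have /cvgrPdist_le/(_ (e / 8)) := cdf_tight; rewrite divr_gt0 // => /(_ isT).
move=> [n _ /(_ n (leqnn n)) /= Hn].
(* The grid runs from [- n] to [n] with mesh [1 / j], hence [2 * n * j] cells. Mesh error and
   missing mass are at most [e / 8] each and count twice; the grid estimate adds [e / 2]. *)
pose j := (Num.trunc (C * 8 / e)).+1; pose eta : R := j%:R^-1.
have eta0 : 0 < eta by rewrite invr_gt0 ltr0n.
have Ceta : C * eta <= e / 8.
  have : C * 8 / e < j%:R by exact: truncnS_gt.
  by rewrite /eta ler_pdivrMr ?ltr0n // ltr_pdivrMr //; lra.
have H := lipschitz_grid_bound mS mZ Hcdf (- n%:R) eta0 (2 * n * j)%N
  (divr_gt0 e0 (ltr0n R 2)) C0.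
move: H; apply: filterS => k Hk h mh h1 hC.
apply: le_trans (Hk h mh h1 hC) _.
rewrite mul0r addr0 (_ : - n%:R + (2 * n * j)%:R * eta = n%:R); last first.
  by rewrite !natrM /eta mulfK ?pnatr_eq0 //; ring.
move: Hn; rewrite ler_norml; lra.
Qed.

End CdfLipschitzUniform.

(** * Substitution of an independent random index *)

Section Independence.
Context d {T : measurableType d} {R : realType} (P : probability T R).

Definition indepE (A : set T) (f : T -> R) : Prop :=
  \int[P]_w (\1_A w * f w) = \int[P]_w \1_A w * \int[P]_w f w.

Lemma indepE_lin (A : set T) (f g : T -> R) (a b : R) : measurable A ->
  bdm f -> bdm g -> indepE A f -> indepE A g -> indepE A (fun w => a * f w + b * g w).
Proof.
move=> mA bf bg If Ig; have bA : bdm (\1_A : T -> R) by exact: bdm_indic.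
have bZ c f' : bdm f' -> bdm (fun w : T => c * f' w :> R).
  by move=> bf'; apply: bdmM => //; exact: bdm_cst.
rewrite /indepE ExpD; [|exact: bZ..]; rewrite !ExpZ // mulrDr.
rewrite (mulrCA _ a) (mulrCA _ b) -If -Ig -!ExpZ; [|exact: bdmM..].
rewrite -ExpD; [|by apply: bZ; exact: bdmM..].
by apply: eq_Rintegral => w _; ring.
Qed.

Lemma indepE_cst (A : set T) (c : R) : measurable A -> indepE A (fun=> c).
Proof.
move=> mA; rewrite /indepE (Exp_cst P) [RHS]mulrC -ExpZ; last exact: bdm_indic.
by apply: eq_Rintegral => w _; rewrite mulrC.
Qed.

Lemma indepE_uniform (A : set T) (f : T -> R) : measurable A -> bdm f ->
  (forall e : R, 0 < e -> exists g, [/\ bdm g, indepE A g & forall w, `|f w - g w| <= e]) ->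
  indepE A f.
Proof.
move=> mA bf H; have bA : bdm (\1_A : T -> R) by exact: bdm_indic.
have A1 w : `|\1_A w| <= 1 :> R by rewrite indicE ger0_norm // lern1 leq_b1.
apply/eqP; rewrite -subr_eq0 -normr_le0; apply/ler_addgt0Pl => e e0; rewrite addr0.
have [g [bg Ig fg]] := H (e / 2) ltac:(lra).
have h1 : `|\int[P]_w (\1_A w * f w) - \int[P]_w (\1_A w * g w)| <= e / 2.
  apply: Exp_dist_le; [exact: bdmM..|] => w.
  by rewrite -mulrBr normrM -[leRHS]mul1r ler_pM.
have h2 : `|\int[P]_w f w - \int[P]_w g w| <= e / 2 by exact: Exp_dist_le.
have h3 : `|\int[P]_w \1_A w * (\int[P]_w f w - \int[P]_w g w)| <= e / 2.
  rewrite normrM -[leRHS]mul1r ler_pM //.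
  by rewrite -[leRHS](Exp_cst P); apply: Exp_norm_le => //; exact: bdm_cst.
move: h1 h3; rewrite Ig mulrBr !ler_norml; lra.
Qed.

(* The sum is the integer part of [t]. *)
Lemma stair_bound (m : nat) (t : R) : 0 <= t <= m%:R ->
  t - 1 <= \sum_(j < m) (j.+1%:R <= t)%R%:R <= t.
Proof.
move=> /andP[t0]; have : 0 <= t by [].
(* The induction also carries the saturated case [m%:R <= s]: when the next step is reached or just
   missed, the exact value of the earlier sum is needed. *)
suff H : forall s, 0 <= s -> [/\ \sum_(j < m) (j.+1%:R <= s)%R%:R <= s :> R,
    m%:R <= s -> \sum_(j < m) (j.+1%:R <= s)%R%:R = m%:R :> R &
    s <= m%:R -> s - 1 <= \sum_(j < m) (j.+1%:R <= s)%R%:R].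
  by move=> /H[h1 _ h2] /h2 ->.
elim: m => [|m IH] s s0.
  by rewrite !big_ord0; split => // h; lra.
have [h1 h2 h3] := IH s s0; rewrite big_ord_recr /=.
have [ms|sm] := leP m.+1%:R s.
  have ms' : m%:R <= s by apply: le_trans ms; rewrite ler_nat.
  by rewrite h2 // natr1; split => // ?; lra.
rewrite addr0; split => // _.
have [ms|/ltW sm'] := leP m%:R s; last exact: h3.
by rewrite h2 //; move: sm; rewrite -natr1; lra.
Qed.

(** Layer cake: [f] is within [1 / m] of the mean of the indicators of its level sets at heights
    [(j + 1) / m]. *)
Lemma indepE_levels (A : set T) (f : T -> R) : measurable A ->
  measurable_fun setT f -> (forall w, 0 <= f w <= 1) ->
  (forall c : R, indepE A (fun w => (c <= f w)%R%:R)) -> indepE A f.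
Proof.
move=> mA mf f01 H.
have bl c : bdm (fun w => (c <= f w)%R%:R : R).
  rewrite (_ : (fun w => _) = \1_(f @^-1` `[c, +oo[)).
    by apply: bdm_indic; rewrite -[X in measurable X]setTI; apply: mf => //; exact: measurable_itv.
  apply/funext => w; rewrite indicE; congr (nat_of_bool _)%:R; apply/idP/idP.
    by move=> h; apply/mem_set; rewrite /= in_itv /= h.
  by move/set_mem; rewrite /= in_itv /= andbT.
have bf : bdm f by split => //; exists 1 => w; case/andP: (f01 w) => *; rewrite ger0_norm.
apply: indepE_uniform => // e e0.
pose m := (Num.trunc e^-1).+1.
have m0 : 0 < m%:R :> R by rewrite ltr0n.
have me : m%:R^-1 <= e.
  by rewrite -[leRHS]invrK lef_pV2 ?posrE ?invr_gt0 // ltW // truncnS_gt.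
have Hs k : bdm (fun w => \sum_(j < k) (j.+1%:R / m%:R <= f w)%R%:R : R) /\
    indepE A (fun w => \sum_(j < k) (j.+1%:R / m%:R <= f w)%R%:R : R).
  elim: k => [|k [IHb IHi]].
    rewrite (_ : (fun w => _) = fun=> 0).
      by split; [exact: bdm_cst|exact: indepE_cst].
    by apply/funext => w; rewrite big_ord0.
  rewrite (_ : (fun w => _) = fun w => 1 * (\sum_(j < k) (j.+1%:R / m%:R <= f w)%R%:R) +
      1 * (k.+1%:R / m%:R <= f w)%R%:R).
    split; last exact: indepE_lin.
    by apply: bdmD; apply: bdmM => //; exact: bdm_cst.
  by apply/funext => w; rewrite !mul1r big_ord_recr.
have [b i] := Hs m.
(* The summand [0 * 0] gives the witness the two-term form of [indepE_lin]. *)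
exists (fun w => m%:R^-1 * (\sum_(j < m) (j.+1%:R / m%:R <= f w)%R%:R) + 0 * 0); split.
- by apply: bdmD; [apply: bdmM => //; exact: bdm_cst|exact: bdm_cst].
- by apply: (@indepE_lin A _ (fun=> 0)) => //; [exact: bdm_cst|exact: indepE_cst].
move=> w; rewrite mul0r addr0; apply: le_trans me.
have /andP[fw0 fw1] := f01 w.
have := @stair_bound m (m%:R * f w); rewrite mulr_ge0 //= ler_piMr // => /(_ isT).
under eq_bigr do rewrite mulrC -ler_pdivrMr //.
set s := \sum_(j < m) _ => /andP[s1 s2].
rewrite (_ : f w - _ = m%:R^-1 * (m%:R * f w - s)); last by field; rewrite gt_eqF.
rewrite normrM [`|_^-1|]ger0_norm ?invr_ge0 // ler_piMr ?invr_ge0 // ger0_norm; lra.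
Qed.

Variables (N : T -> nat) (X : nat -> T -> R).
Hypotheses (mN : measurable_fun setT N) (mX : forall i, measurable_fun setT (X i)).

Let Xt k w := [tuple X i w | i < k].

Lemma measurable_sample k : measurable_fun setT (Xt k).
Proof.
apply/measurable_fun_tnthP => i.
rewrite (_ : _ \o _ = X i) //; apply/funext => w.
by rewrite /= tnth_mktuple.
Qed.

Lemma measurable_Neq k : measurable (N @^-1` [set k]).
Proof. by rewrite -[X in measurable X]setTI; exact: mN. Qed.

Hypothesis indN : indep_nat_seq P N X.

(** Dynkin's theorem: the hypothesis gives the product rule on cylinders, which are stable under
    intersection and generate the sets of tuples, and the events obeying the rule form a
    lambda-system. *)
Lemma indepE_sample k (E : set (k.-tuple R)) : measurable E ->
  indepE (N @^-1` [set k]) (fun w => \1_E (Xt k w)).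
Proof.
set A := N @^-1` [set k]; have mA : measurable A by exact: measurable_Neq.
pose cyl (B : nat -> set R) : set (k.-tuple R) := [set t | forall i : 'I_k, B i (tnth t i)].
pose G := [set E | exists2 B, (forall i, measurable (B i)) & E = cyl B].
have mcyl B : (forall i, measurable (B i)) -> measurable (cyl B).
  move=> mB; rewrite (_ : cyl B = \bigcap_(i : 'I_k) ((@tnth k R ^~ i) @^-1` B i)).
    apply: fin_bigcap_measurable => // i _.
    by rewrite -[X in measurable X]setTI; exact: measurable_tnth.
  by apply/seteqP; split=> t /= h i; [move=> _; exact: h|exact: h].
have GI : setI_closed G.
  move=> _ _ [B mB ->] [B' mB' ->]; exists (fun i => B i `&` B' i).
    by move=> i; exact: measurableI.
  apply/seteqP; split => t /=; first by move=> [h h'] i; split.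
  by move=> h; split => i; have [] := h i.
pose H := [set E : set (k.-tuple R) | measurable E /\ indepE A (fun w => \1_E (Xt k w))].
have bE E' : measurable E' -> bdm (fun w => \1_E' (Xt k w) : R).
  by move=> mE; apply: (bdm_comp (bdm_indic mE)); exact: measurable_sample.
have GH : G `<=` H.
  move=> _ [B mB ->]; split; first exact: mcyl.
  have E1 : (Xt k @^-1` cyl B) = \bigcap_(i in `I_k) (X i @^-1` B i).
    apply/seteqP; split => w /= h.
      by move=> i /= ik; have := h (Ordinal ik); rewrite tnth_mktuple.
    by move=> i; rewrite tnth_mktuple; apply: h => /=.
  have mC : measurable (Xt k @^-1` cyl B).
    by rewrite -[X in measurable X]setTI; apply: measurable_sample => //; exact: mcyl.
  have e1 w : \1_(cyl B) (Xt k w) = \1_(Xt k @^-1` cyl B) w :> R by [].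
  rewrite /indepE; under [X in _ = _ * X]eq_Rintegral do rewrite e1.
  rewrite (_ : (\int[P]_w (\1_A w * \1_(cyl B) (Xt k w))) =
      \int[P]_w \1_(A `&` Xt k @^-1` cyl B) w); last first.
    by apply: eq_Rintegral => w _; rewrite e1 indicI.
  rewrite !Exp_indic //; last exact: measurableI.
  by rewrite E1 indN // fineM //; apply: fin_num_measure; rewrite -?E1.
have LH : lambda_system setT H.
  split => //.
  - split => //; rewrite (_ : (fun w => _) = fun=> 1); first exact: indepE_cst.
    by apply/funext => w; rewrite indicT.
  - move=> E1 E2 E21 [m1 i1] [m2 i2]; split; first exact: measurableD.
    rewrite (_ : (fun w => _) = fun w => 1 * \1_E1 (Xt k w) + -1 * \1_E2 (Xt k w)).
      by apply: indepE_lin => //; exact: bE.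
    apply/funext => w; rewrite mul1r mulN1r !indicE in_setD.
    have [e2|_] := boolP (Xt k w \in E2); last by rewrite andbT subr0.
    by rewrite andbF (mem_set (E21 _ (set_mem e2))) subrr.
  - move=> F ndF HF.
    have mF n : measurable (F n) by case: (HF n).
    have mU : measurable (\bigcup_i F i) by exact: bigcup_measurable.
    split => //.
    have cF t : (fun n => \1_(F n) t : R) @ \oo --> (\1_(\bigcup_i F i) t : R).
      apply: cvg_near_cst; rewrite indicE.
      have [/set_mem[n _ Fn]|tF] := boolP (t \in \bigcup_i F i).
        exists n => // j /= nj; rewrite indicE mem_set //.
        by have /subsetPset := ndF _ _ nj; apply.
      apply: nearW => n; rewrite indicE memNset // => Fn; move/negP: tF; apply.
      by apply/mem_set; exists n.
    have i1 w n : `|\1_(F n) (Xt k w)| <= 1 :> R.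
      by rewrite indicE ger0_norm // lern1 leq_b1.
    have c1 : (fun n => \int[P]_w (\1_A w * \1_(F n) (Xt k w))) @ \oo -->
        \int[P]_w (\1_A w * \1_(\bigcup_i F i) (Xt k w)).
      apply: (@Exp_cvg _ _ _ _ _ _ 1).
      - by move=> n; have [] := bdmM (bdm_indic mA) (bE _ (mF n)).
      - move=> n w; rewrite normrM -[leRHS]mulr1 ler_pM //.
        by rewrite indicE ger0_norm // lern1 leq_b1.
      - by move=> w; apply: cvgM; [exact: cvg_cst|exact: cF].
    have c2 : (fun n => \int[P]_w \1_A w * \int[P]_w \1_(F n) (Xt k w)) @ \oo -->
        \int[P]_w \1_A w * \int[P]_w \1_(\bigcup_i F i) (Xt k w).
      apply: cvgM; first exact: cvg_cst.
      apply: (@Exp_cvg _ _ _ _ _ _ 1).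
      - by move=> n; have [] := bE _ (mF n).
      - by move=> n w; exact: i1.
      - by move=> w; exact: cF.
    rewrite /indepE; apply: (cvg_unique _ c1) => //.
    rewrite (_ : (fun n => _) = fun n =>
      \int[P]_w \1_A w * \int[P]_w \1_(F n) (Xt k w)) //.
    by apply/funext => n; case: (HF n).
move=> mE; suff : H E by case.
apply: (lambda_system_subset GI LH GH) => //.
move: mE; apply: sub_smallest2r => //.
(* A generator constrains a single coordinate; it is the cylinder with the full line in all the
   others. *)
move=> B; rewrite -bigcup_seq => -[i _ [C mC <-]].
exists (fun j => if j == i :> nat then C else setT).
  by move=> j; case: ifP.
apply/seteqP; split => t /=.
  by move=> [_ h] j; case: ifPn => // /eqP/val_inj ->.
by move=> /(_ i); rewrite eqxx.
Qed.

Lemma indepE_statistic k (f : k.-tuple R -> R) : measurable_fun setT f ->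
  (forall t, `|f t| <= 1) -> indepE (N @^-1` [set k]) (fun w => f (Xt k w)).
Proof.
move=> mf f1; have mA := measurable_Neq k; have mXt := @measurable_sample k.
have mg : measurable_fun setT (fun w => f (Xt k w)) by exact: (measurableT_comp mf mXt).
(* The affine image [(1 + f) / 2] has values in [[0, 1]], as the level-set argument requires; it is
   undone by linearity below. *)
have I : indepE (N @^-1` [set k]) (fun w => (1 + f (Xt k w)) / 2).
  apply: indepE_levels => //.
  - by apply: measurable_funM => //; apply: measurable_funD.
  - by move=> w; have := f1 (Xt k w); rewrite ler_norml => /andP[? ?]; apply/andP; split; lra.
  move=> c.
  have mE : measurable (f @^-1` `[2 * c - 1, +oo[).
    by rewrite -[X in measurable X]setTI; apply: mf => //; exact: measurable_itv.
  have := indepE_sample mE; rewrite (_ : (fun w => \1__ _) = fun w =>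
    (c <= (1 + f (Xt k w)) / 2)%R%:R) //.
  apply/funext => w; rewrite indicE; congr (nat_of_bool _)%:R; apply/idP/idP.
    by move/set_mem; rewrite /= in_itv /= andbT; lra.
  by move=> h; apply/mem_set; rewrite /= in_itv /= andbT; lra.
have := indepE_lin 2 (- 1) mA _ (bdm_cst 1) I (indepE_cst 1 mA).
rewrite (_ : (fun w => _ + _) = fun w => f (Xt k w)); last first.
  by apply/funext => w; field.
apply; split; first by apply: measurable_funM => //; apply: measurable_funD.
exists 1 => w; have := f1 (Xt k w); rewrite !ler_norml => /andP[? ?].
by apply/andP; split; lra.
Qed.

End Independence.

Section RandomIndex.
Context d {T : measurableType d} {R : realType} (P : probability T R).
Variables (N : T -> nat) (F : nat -> T -> R).
Hypotheses (mN : measurable_fun setT N) (mF : forall k, measurable_fun setT (F k)).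

Lemma measurable_random_index : measurable_fun setT (fun w => F (N w) w).
Proof.
move=> _ B mB; rewrite setTI.
rewrite (_ : _ @^-1` B = \bigcup_k (N @^-1` [set k] `&` F k @^-1` B)).
  apply: bigcup_measurable => k _; apply: measurableI; first exact: measurable_Neq.
  by rewrite -[X in measurable X]setTI; exact: mF.
apply/seteqP; split => w /=; first by move=> h; exists (N w).
by move=> [k _ [/= -> h]].
Qed.

Hypothesis F1 : forall k w, `|F k w| <= 1.
Hypothesis indF : forall k, indepE P (N @^-1` [set k]) (F k).

(** On the event [N = k] the product rule replaces [F k] by its mean. The infinite sum over [k] is
    avoided: both sides are limits of partial sums that agree term by term. *)
Lemma Exp_random_index :
  \int[P]_w F (N w) w = \int[P]_w (fun k => \int[P]_v F k v) (N w).
Proof.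
pose q k := \int[P]_v F k v.
have bF k : bdm (F k) by split => //; exists 1.
have q1 k : `|q k| <= 1.
  by rewrite -[leRHS](Exp_cst P); apply: Exp_norm_le => //; exact: bdm_cst.
(* Used twice: for [F], and for the constant functions [q k]. *)
have trunc (G : nat -> T -> R) : (forall k, bdm (G k)) -> (forall k w, `|G k w| <= 1) ->
    (fun m : nat => \sum_(k < m) \int[P]_w (\1_(N @^-1` [set (k : nat)]) w * G k w))
    @ \oo --> \int[P]_w G (N w) w.
  move=> bG G1.
  have bGi k : bdm (fun w => \1_(N @^-1` [set k]) w * G k w).
    by apply: bdmM => //; apply: bdm_indic; exact: measurable_Neq.
  pose H m w := \sum_(k < m) (\1_(N @^-1` [set (k : nat)]) w * G k w).
  have HE m : bdm (H m) /\ \int[P]_w H m w =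
      \sum_(k < m) \int[P]_w (\1_(N @^-1` [set (k : nat)]) w * G k w).
    elim: m => [|m [IHb IHe]].
      rewrite /H (_ : (fun w => _) = fun=> 0).
        by rewrite big_ord0 (Exp_cst P); split => //; exact: bdm_cst.
      by apply/funext => w; rewrite big_ord0.
    rewrite (_ : H m.+1 = fun w => H m w + \1_(N @^-1` [set m]) w * G m w); last first.
      by apply/funext => w; rewrite /H big_ord_recr.
    by rewrite ExpD // IHe big_ord_recr; split => //; exact: bdmD.
  have Hv m w : H m w = (N w < m)%N%:R * G (N w) w.
    rewrite /H; elim: m => [|m IH]; first by rewrite big_ord0 mul0r.
    rewrite big_ord_recr /= IH ltnS [in RHS]leq_eqVlt indicE.
    have [<-|Nm] := eqVneq (N w) m.
      by rewrite ltnn mul0r add0r mem_set.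
    by rewrite memNset ?mul0r ?addr0 // => /= h; rewrite h eqxx in Nm.
  rewrite (_ : (fun m => _) = fun m => \int[P]_w H m w); last first.
    by apply/funext => m; case: (HE m).
  apply: (@Exp_cvg _ _ _ _ _ _ 1).
  - by move=> m; have [[]] := HE m.
  - move=> m w; rewrite Hv normrM -[leRHS]mulr1 ler_pM //.
    by rewrite ger0_norm // lern1 leq_b1.
  - move=> w; apply: cvg_near_cst; exists (N w).+1 => // m /= Nm.
    by rewrite Hv Nm mul1r.
have c1 := trunc F bF F1.
have c2 := trunc (fun k _ => q k) (fun k => bdm_cst (q k)) (fun k _ => q1 k).
apply: (cvg_unique _ c1) => //.
rewrite (_ : (fun m => _) = (fun m : nat => \sum_(k < m)
  \int[P]_w (\1_(N @^-1` [set (k : nat)]) w * q k))) //.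
apply/funext => m; apply: eq_bigr => k _; rewrite indF mulrC -ExpZ; last first.
  by apply: bdm_indic; exact: measurable_Neq.
by apply: eq_Rintegral => w _; rewrite mulrC.
Qed.

End RandomIndex.

(** * Convergence in distribution through real expectations *)

Section CvgDist.
Context d {T : measurableType d} d' {T' : measurableType d'} {R : realType}.
Variables (P : probability T R) (Y : nat -> T -> R).
Variables (Q : probability T' R) (Z : T' -> R) (L : (R -> R) -> \bar R).
Hypothesis mY : forall n, measurable_fun setT (Y n).
Hypothesis LE : forall f : R -> R, bdm f -> L f = (\int[Q]_w f (Z w))%:E.

Lemma cvg_dist_cvgE : cvg_dist P Y L ->
  forall (f : R -> R) (M : R), continuous f -> (forall x, `|f x| <= M) -> cvgE P Y Q Z f.
Proof.
move=> H f M cf fM; have bf := bdm_bounded_continuous cf fM.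
have bd : [bounded f x | x in setT].
  exists M; split; first exact: num_real.
  by move=> x Mx y _; apply: le_trans (fM y) _; exact: ltW.
have := H f cf bd; rewrite LE // => h.
exact: fine_cvg h.
Qed.

Lemma cvgE_cvg_dist :
  (forall (f : R -> R) (M : R), continuous f -> (forall x, `|f x| <= M) -> cvgE P Y Q Z f) ->
  cvg_dist P Y L.
Proof.
move=> H f cf bd; have bf := continuous_bdm cf bd.
rewrite LE //; apply: cvg_EFin.
  apply: nearW => n; rewrite -EFin_bdm //; exact: bdm_comp.
by case: (bf) => _ [M fM]; exact: (H f M cf fM).
Qed.

End CvgDist.

(** * Auxiliary real functions and inequalities *)

Section RealLemmas.
Context {R : realType}.

(** The inverse is the pointwise limit of the continuous functions [x / (x ^+ 2 + 1 / (n + 1))],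
    which are 0 at 0 in accordance with [0^-1 = 0]. *)
Lemma measurable_invr : measurable_fun setT (fun x : R => x^-1).
Proof.
apply: (measurable_fun_cvg (h := fun (n : nat) (x : R) => x / (x ^+ 2 + n.+1%:R^-1))).
  move=> n; apply: continuous_measurable_fun => x.
  apply: cvgM; first exact: cvg_id.
  apply: cvgV.
    by rewrite gt_eqF // ltr_wpDl ?sqr_ge0 // invr_gt0 ltr0n.
  by apply: cvgD; [exact: exprn_continuous|exact: cvg_cst].
move=> x _; have [->|x0] := eqVneq x 0.
  rewrite invr0; apply: cvg_near_cst; apply: nearW => n; exact: mul0r.
have -> : x^-1 = x * (x ^+ 2 + 0)^-1 by rewrite addr0; field.
apply: cvgM; first exact: cvg_cst.
apply: cvgV; first by rewrite addr0 expf_eq0.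
by apply: cvgD; [exact: cvg_cst|exact: cvg_harmonic].
Qed.

Lemma cos_lipschitz (u v : R) : `|cos u - cos v| <= `|u - v|.
Proof.
wlog uv : u v / v <= u => [H|].
  by have [/H //|/ltW/H] := leP v u; rewrite distrC [leRHS]distrC.
have cc : {within `[v, u], continuous (cos : R -> R)}.
  by apply: continuous_subspaceT => x; exact: continuous_cos.
have [c _ ->] := MVT_segment uv (fun x _ => is_derive_cos x) cc.
by rewrite normrM ler_piMl // normrN ler_norml sin_geN1 sin_le1.
Qed.

(** The minimum of [|y| / A] and 1, a Lipschitz substitute for the event that [|y|] is large
    compared with [A]. *)
Definition ramp (A y : R) : R := 1 - pos_part (1 - `|y| / A).

Lemma ramp_ge0 A y : 0 < A -> 0 <= ramp A y.
Proof.
move=> A0; rewrite /ramp subr_ge0; apply: pos_part_le => //.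
by rewrite lerBlDr lerDl divr_ge0 // ltW.
Qed.

Lemma ramp_le1 A y : ramp A y <= 1.
Proof. by rewrite /ramp; have := pos_part_ge0 (1 - `|y| / A); lra. Qed.

Lemma norm_ramp A y : 0 < A -> `|ramp A y| <= 1.
Proof. by move=> A0; rewrite ger0_norm ?ramp_le1 ?ramp_ge0. Qed.

Lemma ramp_mono (A B y z : R) : `|y| / A <= `|z| / B -> ramp A y <= ramp B z.
Proof.
move=> h; rewrite /ramp /pos_part.
have := ler_norm (1 - `|z| / B); have := ler_norm (- (1 - `|z| / B)).
rewrite normrN; case: (ger0P (1 - `|y| / A)); case: (ger0P (1 - `|z| / B)); lra.
Qed.

Lemma continuous_ramp A : continuous (ramp A).
Proof.
move=> y; apply: cvgB; first exact: cvg_cst.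
apply: (@continuous_pos_part _ (fun y => 1 - `|y| / A)) => {}y.
apply: cvgB; first exact: cvg_cst.
by apply: cvgM; [apply: cvg_norm; exact: cvg_id|exact: cvg_cst].
Qed.

Lemma bdm_ramp A : 0 < A -> bdm (ramp A).
Proof.
move=> A0; apply: (@bdm_bounded_continuous _ _ 1); first exact: continuous_ramp.
by move=> y; exact: norm_ramp.
Qed.

Lemma ramp1_lipschitz (u v : R) : `|ramp 1 u - ramp 1 v| <= 1 * `|u - v|.
Proof.
rewrite mul1r /ramp !divr1 opprB addrC addrA subrK /pos_part.
have h1 := ler_dist_dist u v.
have h2 : `| `|1 - `|v| | - `|1 - `|u| | | <= `|u - v|.
  apply: le_trans (ler_dist_dist _ _) _; apply: le_trans h1.
  by rewrite (_ : 1 - `|v| - (1 - `|u|) = `|u| - `|v|) //; ring.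
by move: h1 h2; rewrite !ler_norml; lra.
Qed.

Lemma ramp1_cos (y : R) : (1 - cos y) / 2 <= ramp 1 y.
Proof.
have := cos_lipschitz 0 y; rewrite cos0 sub0r normrN => h1.
have h2 := cos_geN1 y; have y0 := normr_ge0 y; rewrite /ramp divr1 /pos_part.
have := ler_norm (1 - cos y); case: (ger0P (1 - `|y|)) => h3 h4; lra.
Qed.

(** The minorant [(1 - cos y) / 2] has the explicit Gaussian mean [(1 - expR (- 1 / 2)) / 2]. *)
Lemma stdnormal_ramp1_gt0 : 0 < \int[stdnormal]_y ramp 1 (y : R).
Proof.
have bc : bdm (fun y : measurableTypeR R => cos (1 * y + 0 : R)).
  by apply: bdm_cos; exact: measurable_funM.
apply: (@lt_le_trans _ _ (\int[stdnormal]_y (2^-1 * (1 - cos (1 * y + 0 : R))))); last first.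
  apply: Exp_le; last by move=> y; rewrite mul1r addr0 mulrC; exact: ramp1_cos.
    by apply: bdmM; [exact: bdm_cst|apply: bdmB => //; exact: bdm_cst].
  exact: bdm_ramp ltr01.
rewrite ExpZ; last by apply: bdmB => //; exact: bdm_cst.
rewrite ExpB //; last exact: bdm_cst.
rewrite (Exp_cst stdnormal) fourier_stdnormal cos0 mul1r mulr_gt0 // subr_gt0.
Qed.

Lemma powR_sqr (t a : R) : (t ^+ 2) `^ (a / 2) = `|t| `^ a.
Proof.
rewrite -(real_normK (num_real t)) -powR_mulrn // -powRrM; congr (_ `^ _).
by field.
Qed.

(** Dropping the summand 1 leaves a power of [s] that equals [e] at the chosen point. The transform
    of [M] thus comes arbitrarily close to 0, which excludes an atom at 0. *)
Lemma laplace_M_small (delta nu e : R) : 0 < delta -> 0 < nu -> 0 < e ->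
  exists2 s : R, 0 < s & (1 + s `^ delta) `^ (- nu) <= e.
Proof.
move=> d0 nu0 e0; pose a := e `^ (- nu^-1).
have a0 : 0 < a by exact: powR_gt0.
exists (a `^ delta^-1); first exact: powR_gt0.
rewrite -powRrM mulVf ?gt_eqF // powRr1; last exact: ltW.
apply: (@le_trans _ _ (a `^ (- nu))).
  rewrite !powRN lef_pV2 ?posrE ?powR_gt0 //; last lra.
  by apply: ge0_ler_powR; rewrite ?nnegrE; lra.
by rewrite /a -powRrM mulrNN mulVf ?gt_eqF // powRr1 // ltW.
Qed.

End RealLemmas.

(** * The generalized Mittag-Leffler law and the law of half its inverse *)

Section MittagLeffler.
Context {R : realType} (delta nu : R) (rho : probability R R).
Hypotheses (d0 : 0 < delta) (nu0 : 0 < nu) (HM : is_law_M delta nu rho).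

(* The absolute value makes this nonnegative everywhere; it changes nothing
   almost surely. *)
Definition half_inv (x : R) : R := (2 * `|x|)^-1.

Lemma measurable_half_inv : measurable_fun setT half_inv.
Proof.
apply: (measurableT_comp measurable_invr); exact: measurable_funM.
Qed.

Lemma law_M_ge0 (f g : R -> \bar R) : measurable_fun setT f -> measurable_fun setT g ->
  (forall x, 0 <= x -> f x = g x) -> (\int[rho]_x f x = \int[rho]_x g x)%E.
Proof.
move=> mf mg fg; apply: ae_eq_integral => //.
exists (`]-oo, 0[%classic); split.
- exact: measurable_itv.
- case: HM => h _; rewrite -[RHS]h; congr (rho _).
  by apply/seteqP; split => x; rewrite /= ?inE.
- move=> x /= h; rewrite in_itv /= ltNge; apply/negP => x0; apply: h => _.
  exact: fg.
Qed.

Lemma laplace_M_abs (s : R) : 0 <= s ->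
  \int[rho]_x expR (- (s * `|x|)) = (1 + s `^ delta) `^ (- nu).
Proof.
move=> s0; case: HM => _ /(_ s s0) h; apply: EFin_inj; rewrite -h.
have me (g : R -> R) : measurable_fun setT g -> measurable_fun setT (fun x => expR (g x)).
  by move=> mg; exact: (measurableT_comp (@measurable_expR R) mg).
have ma : measurable_fun setT (fun x : R => expR (- (s * `|x|))).
  by apply: me; apply: measurableT_comp => //; exact: measurable_funM.
rewrite EFin_bdm; last first.
  split => //; exists 1 => x; rewrite ger0_norm ?expR_ge0 //.
  by rewrite -expR0 ler_expR oppr_le0 mulr_ge0.
apply: law_M_ge0.
- exact/measurable_EFinP.
- by apply/measurable_EFinP; apply: me; apply: measurableT_comp.
- by move=> x x0; rewrite ger0_norm.
Qed.

Lemma bdm_exp_abs (s : R) : 0 <= s -> bdm (fun x : R => expR (- (s * `|x|))).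
Proof.
move=> s0; split.
  apply: (measurableT_comp (@measurable_expR R)); apply: measurableT_comp => //.
  by apply: measurable_funM => //; exact: measurableT_comp.
exists 1 => x; rewrite ger0_norm ?expR_ge0 //.
by rewrite -expR0 ler_expR oppr_le0 mulr_ge0.
Qed.

(** The mass at 0 is at most every value of the Laplace transform. An atom there would be misplaced
    by [half_inv], which maps 0 to 0 instead of infinity. *)
Lemma law_M_no_atom0 : \int[rho]_x \1_[set 0 : R] x = 0.
Proof.
have b0 : bdm (\1_[set 0 : R] : R -> R) by apply: bdm_indic; exact: measurable_set1.
apply/eqP; rewrite eq_le; apply/andP; split; last first.
  by rewrite -[leLHS](Exp_cst rho); apply: Exp_le => //; exact: bdm_cst.
apply/ler_addgt0Pl => e e0; rewrite addr0.
have [s s0 hs] := laplace_M_small d0 nu0 e0; apply: le_trans hs.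
rewrite -(laplace_M_abs (ltW s0)); apply: Exp_le => //; first exact/bdm_exp_abs/ltW.
move=> x; rewrite indicE; have [|_] := boolP (x \in _); last exact: expR_ge0.
by move=> /set_mem /= ->; rewrite normr0 mulr0 oppr0 expR0.
Qed.

(** Away from 0 the two integrands coincide, and at 0 they differ by 1, so the difference is bounded
    by the mass at 0. *)
Lemma Exp_psi_half_inv (s : R) : 0 < s ->
  \int[rho]_x psi s (half_inv x) = (1 + s `^ delta) `^ (- nu).
Proof.
move=> s0; rewrite -(laplace_M_abs (ltW s0)).
have b1 := bdm_comp (bdm_psi s0) measurable_half_inv.
have b2 := bdm_exp_abs (ltW s0).
have b0 : bdm (\1_[set 0 : R] : R -> R) by apply: bdm_indic; exact: measurable_set1.
apply/eqP; rewrite -subr_eq0 -normr_le0 -ExpB // -[leRHS]law_M_no_atom0.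
apply: Exp_norm_le => //; first exact: bdmB.
move=> x; rewrite indicE; have [->|x0] := eqVneq x 0.
  rewrite mem_set // normr0 mulr0 oppr0 expR0 /half_inv normr0 mulr0 invr0 psi_le0 //.
  by rewrite sub0r normrN normr1.
rewrite /half_inv psi_gt0; last by rewrite invr_gt0 mulr_gt0 // normr_gt0.
rewrite (_ : s / _ = s * `|x|); last by field; rewrite normr_eq0.
by rewrite subrr normr0 ler0n.
Qed.

Lemma half_inv_law_intE (f : R -> R) : bdm f ->
  half_inv_law_int rho f = (\int[rho]_x f (half_inv x))%:E.
Proof.
move=> bf; rewrite EFin_bdm; last exact: (bdm_comp bf measurable_half_inv).
have [mf _] := bf; apply: law_M_ge0.
- apply/measurable_EFinP; apply: (measurableT_comp mf).
  by apply: (measurableT_comp measurable_invr); exact: measurable_funM.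
- by apply/measurable_EFinP; apply: (measurableT_comp mf); exact: measurable_half_inv.
- by move=> x x0; rewrite /half_inv ger0_norm.
Qed.

(** The rescaled plateaus shrink to the indicator of [half_inv x = 0], that is of [x = 0]. They
    serve as continuous majorants in the proof of tightness. *)
Lemma half_inv_plateau_cvg :
  (fun m : nat => \int[rho]_x plateau 1 (m%:R * half_inv x)) @ \oo --> (0 : R).
Proof.
have b0 : bdm (\1_[set 0 : R] : R -> R) by apply: bdm_indic; exact: measurable_set1.
rewrite -[X in _ --> X]law_M_no_atom0; apply: (@Exp_cvg _ _ _ _ _ _ 1).
- move=> m; have [mp _] := bdm_plateau (1 : R); apply: (measurableT_comp mp).
  by apply: measurable_funM => //; exact: measurable_half_inv.
- by move=> m x; rewrite ger0_norm ?plateau_ge0 ?plateau_le1.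
- move=> x; rewrite indicE; have [->|x0] := eqVneq x 0.
    rewrite mem_set //; apply: cvg_near_cst; apply: nearW => m.
    by rewrite /half_inv normr0 mulr0 invr0 mulr0 plateau1 // normr0.
  rewrite memNset //; last by move=> /= h; rewrite h eqxx in x0.
  have u0 : 0 < half_inv x by rewrite invr_gt0 mulr_gt0 // normr_gt0.
  apply: cvg_near_cst; near=> m; apply: plateau0.
  rewrite normrM ger0_norm // gtr0_norm // -ler_pdivrMr //.
  near: m; exists (Num.trunc ((1 + 1) / half_inv x)).+1 => // j /= xj.
  by apply: le_trans (ltW (truncnS_gt _)) _; rewrite ler_nat.
Unshelve. all: end_near. Qed.

End MittagLeffler.

(** * The randomised statistic *)

Section Transfer.
Context {R : realType} {d : measure_display} {Omega : measurableType d}.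
Variables (P : probability Omega R) (X : nat -> Omega -> R) (N : nat -> Omega -> nat).
Variables (T : forall k : nat, k.-tuple R -> R) (sigma theta : R).
Hypotheses (mX : forall i, measurable_fun setT (X i))
  (mN : forall n, measurable_fun setT (N n))
  (indN : forall n, indep_nat_seq P (N n) X)
  (Ninf : cvg_in_prob_to_infty P N)
  (mT : forall k, measurable_fun setT (@T k))
  (sigma0 : 0 < sigma).
Hypothesis Hclt : forall x : R,
  (fun n : nat => P [set w | sigma * Num.sqrt n%:R
                        * (T [tuple X i w | i < n] - theta) < x]) @ \oo --> Phi x.

Let dev k w := T [tuple X i w | i < k] - theta.
Let S k w := sigma * Num.sqrt k%:R * dev k w.
Let Y n w := sigma * Num.sqrt n%:R * dev (N n w) w.
Let U n w : R := (N n w)%:R / n%:R.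

Let mdev k : measurable_fun setT (dev k).
Proof.
apply: measurable_funB => //.
have m := @measurable_sample _ _ _ X mX k.
exact: (measurableT_comp (@mT k) m).
Qed.

Let mS k : measurable_fun setT (S k).
Proof. by apply: measurable_funM => //. Qed.

Lemma measurable_randomized n : measurable_fun setT (Y n).
Proof.
apply: (@measurable_random_index _ _ _ (N n)
  (fun k w => sigma * Num.sqrt n%:R * dev k w)) => // k.
exact: measurable_funM.
Qed.

Lemma measurable_size_ratio n : measurable_fun setT (U n).
Proof.
by apply: (@measurable_random_index _ _ _ (N n) (fun k _ => k%:R / n%:R)).
Qed.

Lemma cvgE_below x : cvgE P S stdnormal (id : measurableTypeR R -> R) (below x).
Proof.
have mb k : measurable [set w | S k w < x].
  rewrite (_ : [set w | _] = S k @^-1` `]-oo, x[).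
    by rewrite -[X in measurable X]setTI; apply: mS => //; exact: measurable_itv.
  by apply/seteqP; split => w; rewrite /= in_itv.
have E1 k : \int[P]_w below x (S k w) = fine (P [set w | S k w < x]).
  rewrite -Exp_indic //; apply: eq_Rintegral => w _; rewrite /below indicE.
  by congr (nat_of_bool _)%:R; apply/idP/idP => [h|/set_mem //]; exact/mem_set.
have E2 : (\int[stdnormal]_w below x w)%:E = Phi x.
  rewrite belowE Exp_indic; last exact: measurable_itv.
  by rewrite fineK //; apply: (@fin_num_measure _ _ _ stdnormal); exact: measurable_itv.
rewrite /cvgE; under eq_fun do rewrite E1.
by apply: fine_cvg; rewrite E2; exact: Hclt.
Qed.

Let mid : measurable_fun setT (id : measurableTypeR R -> R).
Proof. by move=> _ A mA; rewrite setTI. Qed.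

Let scaleS n k w : (0 < k)%N ->
  sigma * Num.sqrt n%:R * dev k w = Num.sqrt (n%:R / k%:R) * S k w.
Proof.
move=> k0; rewrite /S -!mulrA [RHS]mulrCA; congr (_ * _); rewrite mulrA; congr (_ * _).
by rewrite -sqrtrM ?divr_ge0 // divfK // pnatr_eq0 -lt0n.
Qed.

Let small K n : R := \int[P]_w (N n w <= K)%N%:R.

Let bdm_N n (f : nat -> R) : (exists M, forall k, `|f k| <= M) -> bdm (fun w => f (N n w)).
Proof.
move=> [M fM]; split; last by exists M => w; exact: fM.
by apply: (@measurable_random_index _ _ _ (N n) (fun k _ => f k)).
Qed.

Let bdm_small K n : bdm (fun w => (N n w <= K)%N%:R : R).
Proof.
apply: (@bdm_N n (fun k => (k <= K)%N%:R)); exists 1 => k.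
by rewrite ger0_norm // lern1 leq_b1.
Qed.

Let small_cvg K : small K @ \oo --> 0.
Proof.
have E n : small K n = fine (P [set w | (N n w <= K)%N]).
  rewrite -Exp_indic.
    apply: eq_Rintegral => w _; rewrite indicE.
    by congr (nat_of_bool _)%:R; apply/idP/idP => [h|/set_mem //]; exact/mem_set.
  rewrite (_ : [set w | _] = N n @^-1` [set k | (k <= K)%N]) //.
  by rewrite -[X in measurable X]setTI; exact: mN.
rewrite (_ : small K = fun n => fine (P [set w | (N n w <= K)%N])); last exact/funext.
by apply: fine_cvg; exact: Ninf.
Qed.

Let Exp_randomized n (h : R -> R) : continuous h -> (forall y, `|h y| <= 1) ->
  \int[P]_w h (Y n w) =
  \int[P]_w (fun k => \int[P]_v h (sigma * Num.sqrt n%:R * dev k v)) (N n w).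
Proof.
move=> ch h1.
have mh : measurable_fun setT h by exact: continuous_measurable_fun.
apply: (@Exp_random_index _ _ _ P (N n)
  (fun k v => h (sigma * Num.sqrt n%:R * dev k v))) => //.
- by move=> k; apply: (measurableT_comp mh); exact: measurable_funM.
- move=> k; apply: (@indepE_statistic _ _ _ P (N n) X (mN n) mX (indN n) k
    (fun t => h (sigma * Num.sqrt n%:R * (@T k t - theta)))) => //.
  apply: (measurableT_comp mh); apply: measurable_funM => //.
  by apply: measurable_funB => //; exact: (@mT k).
Qed.

Let bdm_q n (h : R -> R) : continuous h -> (forall y, `|h y| <= 1) ->
  bdm (fun w => (fun k => \int[P]_v h (sigma * Num.sqrt n%:R * dev k v)) (N n w)).
Proof.
move=> ch h1; apply: (@bdm_N n (fun k => \int[P]_v h (sigma * Num.sqrt n%:R * dev k v))).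
exists 1 => k; rewrite -[leRHS](Exp_cst P); apply: Exp_norm_le => //; last exact: bdm_cst.
by apply: (bdm_comp (bdm_bounded_continuous ch h1)); exact: measurable_funM.
Qed.

(** Tightness of [1 / U n], stated as small probability near 0 for [U n]. *)
Definition size_ratio_tight : Prop := forall e : R, 0 < e ->
  exists2 eta : R, 0 < eta & \forall n \near \oo, \int[P]_w below eta (U n w) <= e.

Let continuous_cos_affine (t c : R) : continuous (fun x : R => cos (t * x + c)).
Proof.
move=> x; apply: differentiable_continuous; apply/derivable1_diffP.
by have [] := is_derive_cos_affine t c x.
Qed.

Lemma randomized_cos (t c : R) : t != 0 -> size_ratio_tight ->
  (fun n => \int[P]_w cos (t * Y n w + c) - cos c * \int[P]_w psi (t ^+ 2) (U n w))
    @ \oo --> (0 : R).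
Proof.
move=> t0 Ht; apply/cvgrPdist_le => /= e e0.
have [eta eta0 Heta] := Ht (e / 8) ltac:(lra).
have t2 : 0 < t ^+ 2 by rewrite exprn_even_gt0.
(* At index [k] the cosine has frequency [a = t * sqrt (n / k)] in [S k], and [k / n >= eta] gives
   [|a| <= C]. The events [N n <= K] and [U n < eta], of probability at most [e / 8] each, are left
   to the trivial bound 2. *)
pose C := `|t| * Num.sqrt eta^-1.
have C0 : 0 <= C by rewrite mulr_ge0 // sqrtr_ge0.
have [K _ HK] := lipschitz_uniform mS mid cvgE_below (e := e / 4)
  ltac:(lra) C0.
have HN : \forall n \near \oo, small K n <= e / 8.
  have /cvgrPdist_le/(_ (e / 8)) := @small_cvg K; rewrite divr_gt0 // => /(_ isT).
  by apply: filterS => n; rewrite sub0r normrN; exact: le_trans (ler_norm _).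
near=> n.
have n0 : (0 < n)%N by near: n; exists 1%N.
have hN : small K n <= e / 8 by near: n.
have hU : \int[P]_w below eta (U n w) <= e / 8 by near: n.
rewrite sub0r normrN.
have h1 y : `|cos (t * y + c)| <= 1 by rewrite ler_norml cos_geN1 cos_le1.
have cc := @continuous_cos_affine t c.
rewrite (Exp_randomized n cc h1).
have bq := bdm_q n cc h1.
have bpsi := bdm_comp (bdm_psi t2) (measurable_size_ratio n).
rewrite -ExpZ // -ExpB //; last by apply: bdmM => //; exact: bdm_cst.
have bb := bdm_comp (bdm_below eta) (measurable_size_ratio n).
apply: (@le_trans _ _ (\int[P]_w ((e / 4 + 2 * below eta (U n w)) + 2 * (N n w <= K)%N%:R))).
  apply: Exp_norm_le.
  - by apply: bdmB => //; apply: bdmM => //; exact: bdm_cst.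
  - apply: bdmD; last by apply: bdmM => //; exact: bdm_cst.
    by apply: bdmD; [exact: bdm_cst|apply: bdmM => //; exact: bdm_cst].
  move=> w; set k := N n w.
  have triv : `|\int[P]_v cos (t * (sigma * Num.sqrt n%:R * dev k v) + c) -
      cos c * psi (t ^+ 2) (U n w)| <= 2.
    apply: le_trans (ler_normB _ _) _; rewrite -[2]/(1 + 1) lerD //.
      rewrite -[leRHS](Exp_cst P); apply: Exp_norm_le => //; last exact: bdm_cst.
      by apply: (bdm_comp (bdm_bounded_continuous cc h1));
        exact: measurable_funM.
    have /andP[p0 p1] := psi01 (U n w) (ltW t2).
    rewrite normrM -[leRHS]mulr1 ler_pM //; first by rewrite ler_norml cos_geN1 cos_le1.
    by rewrite ger0_norm.
  have b01 : 0 <= below eta (U n w) :> R by rewrite /below ler0n.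
  have [kK|kK] := leqP k K; first by apply: le_trans triv _; rewrite /=; lra.
  have [Ue|Ue] := ltP (U n w) eta.
    by apply: le_trans triv _; rewrite /below Ue /=; lra.
  have k0 : (0 < k)%N by apply: leq_ltn_trans kK.
  have kR : 0 < k%:R :> R by rewrite ltr0n.
  have nR : 0 < n%:R :> R by rewrite ltr0n.
  pose a := t * Num.sqrt (n%:R / k%:R).
  have aC : `|a| <= C.
    rewrite /a normrM [`|Num.sqrt _|]ger0_norm ?sqrtr_ge0 // ler_wpM2l // ler_wsqrtr //.
    by rewrite -invf_div lef_pV2 ?posrE ?divr_gt0.
  have := HK k (ltnW kK) (fun y => cos (a * y + c)).
  have -> : \int[stdnormal]_w cos (a * id w + c) = cos c * psi (t ^+ 2) (U n w).
    rewrite fourier_stdnormal psi_gt0 ?divr_gt0 //; congr (_ * expR (- _)).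
    have -> : a ^+ 2 = t ^+ 2 * (n%:R / k%:R) by rewrite /a exprMn sqr_sqrtr // divr_ge0.
    by rewrite /U -/k; field; rewrite !gt_eqF.
  have -> : \int[P]_v cos (a * S k v + c) =
      \int[P]_v cos (t * (sigma * Num.sqrt n%:R * dev k v) + c).
    by apply: eq_Rintegral => v _; rewrite scaleS // /a -mulrA.
  rewrite /= mulr0 addr0 => H.
  apply: (@le_trans _ _ (e / 4)); last by lra.
  apply: H.
  - by apply: continuous_measurable_fun; exact: continuous_cos_affine.
  - by move=> y; rewrite ler_norml cos_geN1 cos_le1.
  - move=> u v; apply: le_trans (cos_lipschitz _ _) _.
    rewrite (_ : a * u + c - _ = a * (u - v)); last by ring.
    by rewrite normrM ler_wpM2r.
rewrite ExpD; [|by apply: bdmD; [exact: bdm_cst|apply: bdmM => //; exact: bdm_cst]|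
  by apply: bdmM => //; exact: bdm_cst].
rewrite ExpD; [|exact: bdm_cst|by apply: bdmM => //; exact: bdm_cst].
rewrite (Exp_cst P) (ExpZ P 2 bb) (ExpZ P 2 (bdm_small K n)).
by move: hN; rewrite /small; lra.
Unshelve. all: end_near. Qed.

(** A rescaled plateau is a continuous majorant of the indicator of [[0, eta[], so its expectation
    follows that of the limit, where it is small. *)
Lemma tight_of_size_ratio (delta nu : R) (rho : probability R R) :
  0 < delta -> 0 < nu -> is_law_M delta nu rho ->
  (forall (f : R -> R) (M : R), continuous f -> (forall x, `|f x| <= M) ->
     cvgE P U rho half_inv f) -> size_ratio_tight.
Proof.
move=> d0 nu0 HM H e e0.
have := half_inv_plateau_cvg d0 nu0 HM => /cvgrPdist_le/(_ (e / 2)).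
rewrite divr_gt0 // => /(_ isT)[m _ /(_ m.+1 (leqnSn m)) /=].
rewrite sub0r normrN => /(le_trans (ler_norm _)) hm.
have m0 : 0 < m.+1%:R :> R by rewrite ltr0n.
exists m.+1%:R^-1; first by rewrite invr_gt0.
pose f (u : R) := plateau 1 (m.+1%:R * u).
have cf : continuous f.
  move=> u; apply: (cvg_comp (fun u => m.+1%:R * u) (plateau 1)).
    by apply: cvgM; [exact: cvg_cst|exact: cvg_id].
  exact: continuous_plateau.
have f1 u : `|f u| <= 1 by rewrite ger0_norm ?plateau_ge0 ?plateau_le1.
have : \forall n \near \oo, `|\int[rho]_w f (half_inv w) - \int[P]_w f (U n w)| <= e / 2.
  by have /cvgrPdist_le := H f 1 cf f1; apply; rewrite divr_gt0.
apply: filterS => n hn.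
have mU := measurable_size_ratio n.
apply: (@le_trans _ _ (\int[P]_w f (U n w))).
  apply: Exp_le.
  - exact: bdm_comp (bdm_below _) mU.
  - exact: bdm_comp (bdm_bounded_continuous cf f1) mU.
  move=> w; rewrite /below; case: ltP => hU; last exact: plateau_ge0.
  rewrite /f plateau1 // ger0_norm; last by rewrite mulr_ge0 // divr_ge0.
  by rewrite mulrC -ler_pdivlMr // div1r ltW.
by move: hn hm; rewrite -/f ler_norml /f; lra.
Qed.

(* If [N n / n] is small, the randomised statistic exceeds a large multiple of
   a variable that is approximately standard normal. *)
Lemma tight_of_randomized (mu : probability R R) :
  (forall (f : R -> R) (M : R), continuous f -> (forall x, `|f x| <= M) ->
     cvgE P Y mu id f) -> size_ratio_tight.
Proof.
move=> H e e0.
(* Half of the Gaussian mean: a normal approximation with error [c0] leaves at least [c0] for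
   [ramp 1 (S k)] once [k >= K]. *)
pose c0 := (\int[stdnormal]_y ramp 1 (y : R)) / 2.
have c00 : 0 < c0 by rewrite divr_gt0 // stdnormal_ramp1_gt0.
have [m mm] : exists m : nat, \int[mu]_x ramp m.+1%:R x <= c0 * e / 4.
  have : (fun m : nat => \int[mu]_x ramp m.+1%:R x) @ \oo --> (0 : R).
    rewrite -[X in _ --> X](Exp_cst mu 0); apply: (@Exp_cvg _ _ _ _ _ _ 1).
    - by move=> m; have [] := @bdm_ramp R m.+1%:R (ltr0Sn _ _).
    - by move=> m x; exact: norm_ramp.
    - move=> x; rewrite -[X in _ --> X](subrr (1 : R)); apply: cvgB; first exact: cvg_cst.
      rewrite -[X in _ --> X](@pos_part_id R 1) //.
      apply: (cvg_comp (fun m : nat => 1 - `|x| / m.+1%:R) pos_part); last first.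
        by apply: (@continuous_pos_part R id) => y; exact: cvg_id.
      have : (fun m : nat => 1 - `|x| / m.+1%:R) @ \oo --> 1 - `|x| * 0.
        apply: cvgB; first exact: cvg_cst.
        by apply: cvgM; [exact: cvg_cst|exact: cvg_harmonic].
      by rewrite mulr0 subr0.
  have ce : 0 < c0 * e / 4 by rewrite divr_gt0 // mulr_gt0.
  move=> /cvgrPdist_le/(_ _ ce)[m _ /(_ m (leqnn m)) /=]; rewrite sub0r normrN => h; exists m.
  exact: le_trans (ler_norm _) h.
pose A : R := m.+1%:R; have A0 : 0 < A by rewrite ltr0n.
have [K _ HK] := lipschitz_uniform mS mid cvgE_below (e := c0) c00 ler01.
have lowK k : (K <= k)%N -> c0 <= \int[P]_w ramp 1 (S k w).
  move=> kK; have := HK k kK (ramp 1); rewrite ler_norml.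
  have [mr _] := @bdm_ramp R 1 ltr01.
  move=> /(_ mr (fun y => norm_ramp y ltr01) ramp1_lipschitz) /andP[+ _].
  by rewrite /c0 /=; lra.
(* If [k / n < A ^- 2], then [sqrt (n / k) > A], so the randomised statistic is at least [A * |S k|]
   in absolute value and its [ramp A] dominates [ramp 1 (S k)]. *)
exists (A ^- 2); first by rewrite invr_gt0 exprn_gt0.
have cr := @continuous_ramp R A.
have hY : \forall n \near \oo, `|\int[mu]_x ramp A x - \int[P]_w ramp A (Y n w)| <= c0 * e / 4.
  have /cvgrPdist_le := H (ramp A) 1 cr (fun y => norm_ramp y A0).
  by apply; rewrite divr_gt0 // mulr_gt0.
have HN : \forall n \near \oo, small K n <= e / 2.
  have /cvgrPdist_le/(_ (e / 2)) := @small_cvg K; rewrite divr_gt0 // => /(_ isT).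
  by apply: filterS => n; rewrite sub0r normrN; exact: le_trans (ler_norm _).
near=> n.
have n0 : (0 < n)%N by near: n; exists 1%N.
have nR : 0 < n%:R :> R by rewrite ltr0n.
have hN : small K n <= e / 2 by near: n.
have hYn : `|\int[mu]_x ramp A x - \int[P]_w ramp A (Y n w)| <= c0 * e / 4 by near: n.
have bb := bdm_comp (bdm_below (A ^- 2)) (measurable_size_ratio n).
have bs := bdm_small K n.
(* The right-hand side is at most [c0 * e / 2] by the choice of [A] and by convergence; dividing by
   [c0] and adding [small K n <= e / 2] gives [e]. Where [N n <= K] the left integrand is at most
   0. *)
have : c0 * (\int[P]_w below (A ^- 2) (U n w) - small K n) <= \int[P]_w ramp A (Y n w).
  rewrite (Exp_randomized n cr (fun y => norm_ramp y A0)) /small -ExpB // -ExpZ; last exact: bdmB.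
  apply: Exp_le.
  - by apply: bdmM; [exact: bdm_cst|exact: bdmB].
  - exact: (bdm_q n cr (fun y => norm_ramp y A0)).
  move=> w; set k := N n w.
  have q0 : 0 <= \int[P]_v ramp A (sigma * Num.sqrt n%:R * dev k v).
    by apply: Rintegral_ge0 => v _; exact: ramp_ge0.
  have [kK|kK] := leqP k K.
    apply: le_trans q0; rewrite pmulr_rle0 // subr_le0 /below /=.
    by rewrite lern1 leq_b1.
  rewrite subr0; rewrite /below; case: ltP => hU /=; last by rewrite mulr0.
  rewrite mulr1; apply: le_trans (lowK k (ltnW kK)) _.
  have k0 : (0 < k)%N by apply: leq_ltn_trans kK.
  have kR : 0 < k%:R :> R by rewrite ltr0n.
  apply: Exp_le.
  - exact: (bdm_comp (bdm_ramp ltr01) (mS k)).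
  - by apply: (bdm_comp (bdm_ramp A0)); exact: measurable_funM.
  move=> v; rewrite scaleS //; apply: ramp_mono.
  move: (S k v) => y; rewrite divr1 normrM [`|Num.sqrt _|]ger0_norm ?sqrtr_ge0 // ler_pdivlMr // mulrC.
  rewrite ler_wpM2r //.
  rewrite -[A]gtr0_norm // -sqrtr_sqr ler_wsqrtr //.
  rewrite -invf_div -(invrK (A ^+ 2)) lef_pV2 ?posrE ?invr_gt0 ?exprn_gt0 ?divr_gt0 //.
  exact: ltW hU.
move=> h.
have {h} : c0 * (\int[P]_w below (A ^- 2) (U n w) - small K n) <= c0 * (e / 2).
  apply: le_trans h _; move: hYn mm; rewrite -/A ler_norml; lra.
rewrite ler_pM2l //; lra.
Unshelve. all: end_near. Qed.

End Transfer.

Lemma law_L_cos {R : realType} (alpha nu : R) (mu : probability R R) (t c : R) :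
  is_law_L alpha nu mu ->
  \int[mu]_x cos (t * x + c) = cos c * (1 + `|t| `^ alpha) `^ (- nu).
Proof.
move=> /(_ t)[hc hs].
have mt : measurable_fun setT (fun x : R => t * x) by exact: measurable_funM.
have bc : bdm (fun x : R => cos (t * x)).
  have := bdm_cos 0 mt.
  by under eq_fun do rewrite addr0.
(* The sine is a cosine with phase [- (pi / 2)], so [bdm_cos] covers it. *)
have bs : bdm (fun x : R => sin (t * x)).
  have := bdm_cos (- (pi / 2)) mt.
  by under eq_fun do rewrite cosBpihalf.
have hs' : \int[mu]_x sin (t * x) = 0 by rewrite /Rintegral hs.
have hc' : \int[mu]_x cos (t * x) = (1 + `|t| `^ alpha) `^ (- nu) by rewrite /Rintegral hc.
transitivity (\int[mu]_x (cos c * cos (t * x) - sin c * sin (t * x))).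
  by apply: eq_Rintegral => x _; rewrite cosD; ring.
rewrite ExpB; [|by apply: bdmM => //; exact: bdm_cst..].
by rewrite (ExpZ _ _ bc) (ExpZ _ _ bs) hc' hs' mulr0 subr0.
Qed.

Unset Implicit Arguments.

(* X k is X_{k+1};  T k is the statistic T_k : R^k -> R on k-tuples. *)
Theorem theorem8 (R : realType) (alpha nu : R)
  (d : measure_display) (Omega : measurableType d) (P : probability Omega R)
  (X : nat -> Omega -> R) (N : nat -> Omega -> nat)
  (T : forall k : nat, k.-tuple R -> R) (sigma theta : R)
  (mu rho : probability R R) :
  0 < alpha -> alpha <= 2 -> 0 < nu ->
  (forall i, measurable_fun setT (X i)) ->
  (forall n, measurable_fun setT (N n)) ->
  (forall n, indep_nat_seq P (N n) X) ->
  cvg_in_prob_to_infty P N ->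
  (forall k, measurable_fun setT (T k)) ->
  0 < sigma ->
  (forall x : R,
     (fun n : nat => P [set w | sigma * Num.sqrt n%:R
                          * (T n [tuple X i w | i < n] - theta) < x])
       @ \oo --> Phi x) ->
  is_law_L alpha nu mu ->
  is_law_M (alpha / 2) nu rho ->
  (cvg_dist P
     (fun n w => sigma * Num.sqrt n%:R
                 * (T (N n w) [tuple X i w | i < N n w] - theta))
     (law_int mu)
   <->
   cvg_dist P (fun n w => (N n w)%:R / n%:R) (half_inv_law_int rho)).
Proof.
move=> alpha0 _ nu0 mX mN indN Ninf mT sigma0 Hclt HL HM.
have d0 : 0 < alpha / 2 by rewrite divr_gt0.
pose Y n w := sigma * Num.sqrt n%:R * (T (N n w) [tuple X i w | i < N n w] - theta).
pose U n w : R := (N n w)%:R / n%:R.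
rewrite -/Y -/U.
have mY : forall n, measurable_fun setT (Y n).
  exact: (measurable_randomized sigma theta mX mN mT).
have mU : forall n, measurable_fun setT (U n) by exact: (measurable_size_ratio mN).
have mid : measurable_fun setT (id : R -> R) by exact: measurable_id.
have muE (f : R -> R) : bdm f -> law_int mu f = (\int[mu]_x f (id x))%:E.
  by move=> bf; rewrite EFin_bdm.
have rhoE := @half_inv_law_intE _ _ _ _ HM.
have link t c : t != 0 -> size_ratio_tight P N -> _ :=
  @randomized_cos _ _ _ P X N T sigma theta mX mN indN Ninf mT Hclt t c.
split=> H.
- have HY := cvg_dist_cvgE muE H.
  have Ht := @tight_of_randomized _ _ _ P X N T sigma theta mX mN indN Ninf mT Hclt mu HY.
  apply: (cvgE_cvg_dist mU rhoE).
  apply: laplace_continuity => //.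
  + exact: measurable_half_inv.
  + by move=> n w; rewrite divr_ge0.
  + by move=> x; rewrite invr_ge0 mulr_ge0.
  move=> s s0; rewrite /cvgE (Exp_psi_half_inv d0 nu0 HM s0).
  (* The Laplace variable [s] of [M] corresponds to the frequency [sqrt s] of [L]. *)
  pose t := Num.sqrt s; have t2 : t ^+ 2 = s by rewrite sqr_sqrtr // ltW.
  have t0 : t != 0 by rewrite gt_eqF // sqrtr_gt0.
  have h1 := link t 0 t0 Ht.
  have h2 : (fun n => \int[P]_w cos (t * Y n w + 0)) @ \oo -->
      (1 + s `^ (alpha / 2)) `^ (- nu).
    have := HY (fun x => cos (t * x + 0)) 1.
    rewrite /cvgE (law_L_cos t 0 HL) cos0 mul1r -t2 powR_sqr; apply.
    + move=> x; apply: differentiable_continuous; apply/derivable1_diffP.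
      by have [] := is_derive_cos_affine t 0 x.
    + by move=> x; rewrite ler_norml cos_geN1 cos_le1.
  rewrite (_ : (fun n => _) = fun n => \int[P]_w cos (t * Y n w + 0) -
      (\int[P]_w cos (t * Y n w + 0) - cos 0 * \int[P]_w psi (t ^+ 2) (U n w))).
    by rewrite -[X in _ --> X]subr0; exact: cvgB h2 h1.
  by apply/funext => n; rewrite t2 cos0 mul1r opprB addrC subrK.
- have HU := cvg_dist_cvgE rhoE H.
  have Ht := tight_of_size_ratio mN d0 nu0 HM HU.
  apply: (cvgE_cvg_dist mY muE).
  apply: levy_continuity => // t c; rewrite /cvgE (law_L_cos t c HL).
  (* [randomized_cos] requires [t != 0]; at frequency 0 both sides equal [cos c], because the power
     of 0 with exponent [alpha != 0] is 0. *)
  have [->|t0] := eqVneq t 0.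
    rewrite normr0 powR0 ?gt_eqF // addr0 powR1 mulr1.
    rewrite (_ : (fun n => _) = fun=> cos c); first exact: cvg_cst.
    apply/funext => n; rewrite -[RHS](Exp_cst P); apply: eq_Rintegral => w _.
    by rewrite mul0r add0r.
  have t2 : 0 < t ^+ 2 by rewrite exprn_even_gt0.
  have h1 := link t c t0 Ht.
  have h2 : (fun n => \int[P]_w psi (t ^+ 2) (U n w)) @ \oo -->
      (1 + `|t| `^ alpha) `^ (- nu).
    have := HU (psi (t ^+ 2)) 1 (continuous_psi t2).
    rewrite /cvgE (Exp_psi_half_inv d0 nu0 HM t2) powR_sqr; apply => u.
    by have /andP[p0 p1] := psi01 u (ltW t2); rewrite ger0_norm.
  rewrite (_ : (fun n => _) = fun n => (\int[P]_w cos (t * Y n w + c) -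
      cos c * \int[P]_w psi (t ^+ 2) (U n w)) + cos c * \int[P]_w psi (t ^+ 2) (U n w)).
    rewrite -[X in _ --> X]add0r; apply: cvgD; first exact: h1.
    by apply: cvgM; [exact: cvg_cst|exact: h2].
  by apply/funext => n; rewrite subrK.
Qed.
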